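(* Let $C\subset G:=\mathbb{G}\mathrm{r}(1,3)$ be a smooth irreducible projective curve over $\mathbb{C}$ in the Grassmannian of lines in $\mathbb{P}^3$. Suppose that $C$ parameterizes a one-parameter family of lines in $\mathbb{P}^3$ such that any two distinct lines in the family do not intersect. Then the genus $g$ of the curve $C$ must be $0$.
   Context: $\mathbb{G}\mathrm{r}(1,3)$ denotes the Grassmannian of lines in complex projective $3$-space $\mathbb{P}^3$. *)

(* Defs.v *)
From HB Require Import structures.
From mathcomp Require Import all_boot all_order all_algebra.
From mathcomp Require Import boolp classical_sets reals.
From mathcomp Require Import complex mpoly.

Set Implicit Arguments.
Unset Strict Implicit.
Unset Printing Implicit Defensive.

Import Order.TTheory GRing.Theory Num.Theory.

Local Open Scope classical_set_scope.
Local Open Scope ring_scope.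

(* A subset of the projective space with n homogeneous coordinates (that is, of
   P^(n-1)) is represented by the set of all the nonzero coordinate vectors of
   its points. Such a set is a cone with its apex 0 removed. *)

Definition eval_at (K : fieldType) (n : nat) (F : {mpoly K[n]})
  (x : 'rV[K]_n) : K := F.@[x ord0].

Definition diff_at (K : fieldType) (n : nat) (F : {mpoly K[n]})
  (x w : 'rV[K]_n) : K := \sum_(i < n) eval_at F^`M(i) x * w ord0 i.

Definition homogeneous (K : fieldType) (n : nat) (F : {mpoly K[n]}) : Prop :=
  exists d : nat, F \is d.-homog.

Definition proj_closed (K : fieldType) (n : nat) (X : set 'rV[K]_n) : Prop :=
  exists S : set {mpoly K[n]},
    (forall F, S F -> homogeneous F) /\
    X = [set x | x != 0 /\ forall F, S F -> eval_at F x = 0].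

Definition proj_irreducible (K : fieldType) (n : nat) (X : set 'rV[K]_n) :
    Prop :=
  X !=set0 /\
  forall Y Z : set 'rV[K]_n, proj_closed Y -> proj_closed Z ->
    X `<=` Y `|` Z -> X `<=` Y \/ X `<=` Z.

Definition has_chain (K : fieldType) (n : nat) (X : set 'rV[K]_n) (d : nat) :
    Prop :=
  exists Z : nat -> set 'rV[K]_n,
    (forall i, (i <= d)%N ->
       [/\ proj_closed (Z i), proj_irreducible (Z i) & Z i `<=` X]) /\
    (forall i, (i < d)%N -> Z i `<` Z i.+1).

Definition proj_dim (K : fieldType) (n : nat) (X : set 'rV[K]_n) (d : nat) :
    Prop :=
  has_chain X d /\ ~ has_chain X d.+1.

(* The Zariski tangent space at x of the affine cone over X; the projective
   tangent space of X at the point [x] is its quotient by the line <[x]>. *)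
Definition tangent (K : fieldType) (n : nat) (X : set 'rV[K]_n)
    (x : 'rV[K]_n) : set 'rV[K]_n :=
  [set w | forall F : {mpoly K[n]}, homogeneous F ->
     (forall y, X y -> eval_at F y = 0) -> diff_at F x w = 0].

(* The tangent spaces of the cone have one dimension more than those of X. *)
Definition smooth_of_dim (K : fieldType) (n : nat) (X : set 'rV[K]_n)
    (d : nat) : Prop :=
  forall x, X x -> exists T : {vspace 'rV[K]_n},
    [set` T] = tangent X x /\ \dim T = d.+1.

Definition smooth_projective_curve (K : fieldType) (n : nat)
    (X : set 'rV[K]_n) : Prop :=
  [/\ proj_closed X, proj_irreducible X, proj_dim X 1 & smooth_of_dim X 1].

Record ratfun (K : fieldType) (n : nat) := Ratfun {
  rf_deg : nat;
  rf_num : {mpoly K[n]};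
  rf_den : {mpoly K[n]};
  rf_num_homog : rf_num \is rf_deg.-homog;
  rf_den_homog : rf_den \is rf_deg.-homog
}.

Definition rf_defined (K : fieldType) (n : nat) (f : ratfun K n)
  (x : 'rV[K]_n) : Prop := eval_at (rf_den f) x != 0.

Definition rf_val (K : fieldType) (n : nat) (f : ratfun K n)
  (x : 'rV[K]_n) : K := eval_at (rf_num f) x / eval_at (rf_den f) x.

Definition rf_diff (K : fieldType) (n : nat) (f : ratfun K n)
  (x w : 'rV[K]_n) : K :=
  (diff_at (rf_num f) x w * eval_at (rf_den f) x
   - eval_at (rf_num f) x * diff_at (rf_den f) x w) / eval_at (rf_den f) x ^+ 2.

(* A differential form on X assigns to every point x a covector at x, here a
   function of the tangent vectors w at x. It is regular if near every point of
   X it is a finite sum of forms f dg, with f and g regular functions. Then each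
   covector is automatically linear on [tangent X x] and zero on x, because f
   and g are homogeneous of degree 0. Values of the form outside X, or on
   vectors that are not tangent, are irrelevant. *)
Definition regular_form (K : fieldType) (n : nat) (X : set 'rV[K]_n)
    (omega : 'rV[K]_n -> 'rV[K]_n -> K) : Prop :=
  forall x, X x -> exists (r : nat) (f g : 'I_r -> ratfun K n),
    (forall i, rf_defined (f i) x /\ rf_defined (g i) x) /\
    (forall y, X y -> (forall i, rf_defined (f i) y /\ rf_defined (g i) y) ->
       forall w, tangent X y w ->
         omega y w = \sum_(i < r) rf_val (f i) y * rf_diff (g i) y w).

(* [has_genus X g]: the space of regular differential forms on X has a basis
   with g elements. *)
Definition has_genus (K : fieldType) (n : nat) (X : set 'rV[K]_n) (g : nat) :
    Prop :=
  exists omega : 'I_g -> 'rV[K]_n -> 'rV[K]_n -> K,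
    (forall i, regular_form X (omega i)) /\
    (forall eta, regular_form X eta -> exists! c : 'rV[K]_g,
       forall x, X x -> forall w, tangent X x w ->
         eta x w = \sum_(i < g) c ord0 i * omega i x w).

(* Gr(1,3): lines of P^3 are planes through 0 in K^4. *)
Definition Gr13 (K : fieldType) : Type :=
  {L : {vspace 'rV[K]_4} | \dim L == 2%N}.

Definition line_space (K : fieldType) (L : Gr13 K) : {vspace 'rV[K]_4} :=
  val L.

Definition plucker_pairs : 6.-tuple ('I_4 * 'I_4) :=
  [tuple (0, 1); (0, 2%:R); (0, 3%:R); (1, 2%:R); (1, 3%:R); (2%:R, 3%:R)].

Definition plucker (K : fieldType) (u v : 'rV[K]_4) : 'rV[K]_6 :=
  \row_(k < 6) (let ij := tnth plucker_pairs k in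
                u ord0 ij.1 * v ord0 ij.2 - u ord0 ij.2 * v ord0 ij.1).

(* All the bases (u, v) of the lines are used, so this is a cone. *)
Definition plucker_image (K : fieldType) (C : set (Gr13 K)) : set 'rV[K]_6 :=
  [set x | exists L u v, [/\ C L, line_space L = <<[:: u; v]>>%VS
                           & x = plucker u v]].

(* Main.v *)
Require Import Defs.
From HB Require Import structures.
From mathcomp Require Import all_boot all_order all_algebra.
From mathcomp Require Import ring_quotient generic_quotient.
From mathcomp Require Import boolp classical_sets reals.
From mathcomp Require Import complex mpoly ring zify.

(** The Klein quadric carries a bilinear form [B] on the six Plucker coordinates, and
    two lines meet exactly when the form vanishes on their coordinates. So on the
    curve [X] of the family, [B x z = 0] if and only if [x] and [z] are the same
    point: the polar hyperplane of a point [y] of [X] meets [X] at [y] only. This is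
    the only property of the family that matters, and it makes [X] rational
    ([genus_zero]).

    Near a general point [y], the function [z |-> B y z] vanishes at [z = y] to some
    order [d], the same for all general [y]. Let [y'] be a tangent vector at [y].
    Differentiating with respect to [y] shows that [B y' z] vanishes there to order
    exactly [d - 1], because the characteristic is 0 ([pairing1_flat],
    [pairing1_top]). Hence [h z = B y' z / B y z] has a simple pole at [y] and no
    other pole. Subtracting a polynomial in [h] from a quotient [z_k / B y z] removes
    its pole ([coordinate_expansion]), and a function without poles is constant
    ([coordinate_polynomial]). So the coordinates of the points of [X] are
    polynomials in [h], up to a common factor: the curve is parametrized by the
    projective line, with [y] at infinity ([rational_parametrization]). On such a
    curve a regular form pulls back to [r t dt], where [r] is a rational function
    that is regular for all [t] and vanishes at infinity, and so is zero
    ([regular_form_zero]).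

    Three tools carry this out. The order of vanishing is measured by iterating a
    polynomial vector field [W] tangent to the curve, which exists because the
    Jacobian matrix of the equations is nowhere of full rank ([vector_field]).
    Smoothness makes the maximal ideal of the local ring principal
    ([local_parameter]), and Hilbert's basis theorem ([noeth_mpoly]) excludes nonzero
    functions of infinite order ([flat_all]), whence [d] is finite ([contact_order]).
    That a nonconstant function has a pole on the curve is shown with places: its
    inverse is sent to 0 by a partial morphism from the function field to the
    constants, which extends to one defined on a valuation ring ([place_pole],
    [maximal_total]), and the values of the homogeneous coordinates give a point of
    the curve at which the function cannot be regular ([place_center],
    [place_finite]). *)

Set Implicit Arguments.
Unset Strict Implicit.
Unset Printing Implicit Defensive.
Import Order.TTheory GRing.Theory Num.Theory.
Local Open Scope classical_set_scope.
Local Open Scope ring_scope.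

(** * The field of fractions of a quotient by a prime ideal *)

Section PrimeQuotient.
Variables (R : comNzRingType) (I : prime_idealr R).

Definition prime_quot := Quotient.quot I.
HB.instance Definition _ := GRing.ComNzRing.on prime_quot.

(** The inverse is chosen classically: [{fraction _}] is built over an integral
    domain in which the units are given as a boolean predicate. *)
Definition prime_quot_unit (x : prime_quot) := `[< exists y, y * x = 1 >].
Definition prime_quot_inv (x : prime_quot) :=
  if pselect (exists y, y * x = 1) is left e then projT1 (cid e) else x.

Lemma prime_quot_mulVr : {in prime_quot_unit,
  left_inverse 1 prime_quot_inv *%R}.
Proof.
move=> x /asboolP xu; rewrite /prime_quot_inv; case: pselect => // e.
exact: (projT2 (cid e)).
Qed.

Lemma prime_quot_unitP (x y : prime_quot) : y * x = 1 -> prime_quot_unit x.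
Proof. by move=> yx; apply/asboolP; exists y. Qed.

Lemma prime_quot_inv_out : {in [predC prime_quot_unit], prime_quot_inv =1 id}.
Proof.
move=> x /asboolP xu; rewrite /prime_quot_inv; case: pselect => // e.
Qed.

HB.instance Definition _ := GRing.ComNzRing_hasMulInverse.Build prime_quot
  prime_quot_mulVr prime_quot_unitP prime_quot_inv_out.

HB.instance Definition _ := GRing.ComUnitRing_isIntegral.Build prime_quot
  (@Quotient.rquot_IdomainAxiom R I).

Definition to_prime_quot : R -> prime_quot := \pi_(Quotient.quot I)%qT.

Lemma to_prime_quot_zmod : zmod_morphism to_prime_quot.
Proof. by move=> x y; rewrite /to_prime_quot !piE. Qed.

Lemma to_prime_quot_monoid : monoid_morphism to_prime_quot.
Proof. by split=> [|x y]; rewrite /to_prime_quot !piE. Qed.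

HB.instance Definition _ :=
  GRing.isZmodMorphism.Build R prime_quot to_prime_quot to_prime_quot_zmod.
HB.instance Definition _ :=
  GRing.isMonoidMorphism.Build R prime_quot to_prime_quot to_prime_quot_monoid.

Lemma to_prime_quot_eq0 x : (to_prime_quot x == 0) = (x \in I).
Proof.
rewrite -(rmorph0 to_prime_quot) /to_prime_quot -Quotient.idealrBE subr0 //.
Qed.

End PrimeQuotient.

Definition prime_set (R : comNzRingType) (I : set R) : Prop :=
  [/\ I 0, ~ I 1, forall a u v, I u -> I v -> I (a * u + v)
    & forall u v, I (u * v) -> I u \/ I v].

Section PrimeFrac.
Variables (R : comNzRingType) (I : set R) (Ip : prime_set I).

Let J : {pred R} := fun x => `[< I x >].

Let J_idealr : idealr_closed J.
Proof.
case: Ip => I0 I1 Il _; split; first exact/asboolP.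
  by apply/asboolP.
by move=> a u v /asboolP Iu /asboolP Iv; apply/asboolP/Il.
Qed.

Let J_prime : prime_idealr_closed J.
Proof.
case: Ip => _ _ _ Im u v /asboolP/Im[] h; apply/orP; [left|right];
  exact/asboolP.
Qed.

HB.instance Definition _ := isIdealr.Build R J J_idealr.
HB.instance Definition _ := isPrimeIdealrClosed.Build R J J_prime.
Let JJ : prime_idealr R := J.

(** The residue field of a prime ideal, in the form in which it is used: a
    morphism to a field whose kernel is the ideal and which reaches every element
    up to a quotient. *)
Lemma residue_fieldP : exists (L : fieldType) (f : {rmorphism R -> L}),
  (forall x, f x = 0 <-> I x) /\ (forall l, exists x y, ~ I y /\ l = f x / f y).
Proof.
pose Q := prime_quot JJ.
pose f : {rmorphism R -> {fraction Q}} :=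
  (@tofrac Q) \o (@to_prime_quot R JJ).
exists {fraction Q}, f.
have f0 x : f x = 0 <-> I x.
  split=> [/eqP|Ix].
    by rewrite /f /= tofrac_eq0 to_prime_quot_eq0 => /asboolP.
  by apply/eqP; rewrite /f /= tofrac_eq0 to_prime_quot_eq0; apply/asboolP.
split=> // l.
elim/quotW: l => /= l.
exists (repr l.1); exists (repr l.2).
have e (q : Q) : to_prime_quot JJ (repr q) = q by rewrite /to_prime_quot reprK.
split.
  move/f0 => /eqP; rewrite /f /= e tofrac_eq0; apply/negP; exact: denom_ratioP.
rewrite /f /= !e.
have d0 : l.2 != 0 by exact: denom_ratioP.
have d0' : tofrac l.2 != 0 by rewrite tofrac_eq0.
apply: (mulIf d0'); rewrite divfK //.
have tofracE q : \pi_({fraction Q})%qT (Ratio q 1) = tofrac q.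
  by unlock FracField.tofrac.
rewrite -!tofracE; apply: (eq_trans (esym (FracField.pi_mul _ _))).
apply/eqP; rewrite piE /= /FracField.equivf /FracField.mulf.
rewrite !numden_Ratio ?mulf_neq0 ?oner_neq0 //.
by rewrite !mulr1 mulrC.
Qed.
End PrimeFrac.

(** * Places of a field extension *)

Section Places.
Variables (K : closedFieldType) (L : fieldType) (io : {rmorphism K -> L}).

Let pairM (a c : L) (b d : K) : (a, b) * (c, d) = (a * c, b * d) :> L * K.
Proof. by []. Qed.
Let pairD (a c : L) (b d : K) : (a, b) + (c, d) = (a + c, b + d) :> L * K.
Proof. by []. Qed.
Let pairN (a : L) (b : K) : - (a, b) = (- a, - b) :> L * K.
Proof. by []. Qed.

(** A partial morphism from [L] to [K] is represented by its graph, a subalgebra of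
    [L * K]. Excluding [(0, 1)] makes the graph functional, and this form of the
    condition passes to unions of chains. *)
Definition place_alg (A : set (L * K)) : Prop :=
  [/\ forall c, A (io c, c),
      forall v w, A v -> A w -> A (v + w),
      forall v w, A v -> A w -> A (v * w)
    & ~ A (0, 1)].

Definition adjoin (A : set (L * K)) (u : L * K) : set (L * K) :=
  [set v | exists p : {poly L * K}, (forall i, A p`_i) /\ v = p.[u]].

Definition maximal_alg (A : set (L * K)) : Prop :=
  place_alg A /\ forall B, place_alg B -> A `<=` B -> B `<=` A.

Section Alg.
Variables (A : set (L * K)) (Aalg : place_alg A).

Lemma place_alg0 : A 0.
Proof. by have [h _ _ _] := Aalg; have := h 0; rewrite rmorph0. Qed.

Lemma place_alg1 : A 1.
Proof. by have [h _ _ _] := Aalg; have := h 1; rewrite rmorph1. Qed.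

Lemma place_algD v w : A v -> A w -> A (v + w).
Proof. by have [_ h _ _] := Aalg; exact: h. Qed.

Lemma place_algM v w : A v -> A w -> A (v * w).
Proof. by have [_ _ h _] := Aalg; exact: h. Qed.

Lemma place_algN v : A v -> A (- v).
Proof.
move=> Av; rewrite -mulN1r; apply: place_algM => //.
by have [h _ _ _] := Aalg; have := h (-1); rewrite rmorphN1.
Qed.

Lemma place_algX v n : A v -> A (v ^+ n).
Proof.
move=> Av; elim: n => [|n IH]; first by rewrite expr0; exact: place_alg1.
by rewrite exprS; exact: place_algM.
Qed.

Lemma place_alg_sum I (r : seq I) (P : pred I) (F : I -> L * K) :
  (forall i, P i -> A (F i)) -> A (\sum_(i <- r | P i) F i).
Proof.
by move=> h; apply: big_ind => //; [exact: place_alg0 | exact: place_algD].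
Qed.

Lemma place_alg_neq0 c : A (0, c) -> c = 0.
Proof.
move=> Ac; apply/eqP; apply: contrapT => /negP c0.
have [h1 _ h3 h4] := Aalg; apply: h4.
have := h3 _ _ (h1 c^-1) Ac; by rewrite pairM mulr0 mulVf.
Qed.

Lemma place_alg_fun v c d : A (v, c) -> A (v, d) -> c = d.
Proof.
move=> Ac Ad; apply/eqP; rewrite -subr_eq0; apply/eqP/place_alg_neq0.
by have := place_algD Ac (place_algN Ad); rewrite pairN pairD subrr.
Qed.

Lemma adjoin_sub u : A `<=` adjoin A u.
Proof.
move=> a Aa; exists a%:P; rewrite hornerC; split=> // i.
by rewrite coefC; case: ifP => // _; exact: place_alg0.
Qed.

Lemma adjoin_mem u : adjoin A u u.
Proof.
exists 'X; rewrite hornerX; split=> // i; rewrite coefX.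
by case: eqP => _; [exact: place_alg1|exact: place_alg0].
Qed.

Lemma adjoin_alg u : ~ adjoin A u (0, 1) -> place_alg (adjoin A u).
Proof.
move=> h; split=> //.
- by move=> c; apply: adjoin_sub; have [] := Aalg.
- move=> _ _ [p [hp ->]] [q [hq ->]]; exists (p + q); rewrite hornerD.
  by split=> // i; rewrite coefD; exact: place_algD.
- move=> _ _ [p [hp ->]] [q [hq ->]]; exists (p * q); rewrite hornerM.
  split=> // i; rewrite coefM; apply: place_alg_sum => j _.
  exact: place_algM.
Qed.

End Alg.

(** Zorn's lemma. The empty set is admitted among the candidates only because the
    union of the empty chain is empty. *)
Lemma maximal_alg_exists G : place_alg G ->
  exists A, maximal_alg A /\ G `<=` A.
Proof.
move=> Galg.
pose P (A : set (L * K)) := A = set0 \/ (place_alg A /\ G `<=` A).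
have [] := @Zorn_bigcup _ P.
  move=> F FP Ftot.
  case: (pselect (exists2 X, F X & X !=set0)) => [[X0 FX0 [x0 Xx0]]|h]; last first.
    left; apply/seteqP; split=> // x [X FX Xx]; exfalso; apply: h.
    by exists X => //; exists x.
  have big2 x y : (\bigcup_(X in F) X) x -> (\bigcup_(X in F) X) y ->
      exists X, [/\ F X, X x, X y & place_alg X].
    move=> [X FX Xx] [Y FY Yy].
    have [] := Ftot _ _ FX FY => XY.
      exists Y; split=> //; first exact: XY.
      by have [Y0|[]//] := FP _ FY; move: Yy; rewrite Y0.
    exists X; split=> //; first exact: XY.
    by have [X0'|[]//] := FP _ FX; move: Xx; rewrite X0'.
  have [X00|[X0alg GX0]] := FP _ FX0; first by move: Xx0; rewrite X00.
  right; split; last by move=> g Gg; exists X0 => //; exact: GX0.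
  split.
  - by move=> c; exists X0 => //; have [] := X0alg.
  - move=> v w Uv Uw; have [X [FX Xv Xw Xalg]] := big2 _ _ Uv Uw.
    by exists X => //; exact: place_algD.
  - move=> v w Uv Uw; have [X [FX Xv Xw Xalg]] := big2 _ _ Uv Uw.
    by exists X => //; exact: place_algM.
  - move=> U1; have [X [FX X1 _ []]] := big2 _ _ U1 U1.
    by move=> _ _ _; apply.
move=> A [PA maxA]; exists A.
have [A0|[Aalg GA]] := PA.
  exfalso; apply: (maxA G); last by right; split.
  rewrite A0; split=> // /(_ _ (place_alg1 Galg)); exact.
split=> //; split=> // B Balg AB; apply: contrapT => BA; apply: (maxA B).
  by split.
by right; split=> // g Gg; apply/AB/GA.
Qed.

Section Maximal.
Variables (A : set (L * K)) (Amax : maximal_alg A).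
Let Aalg : place_alg A := Amax.1.

Lemma maximal_adjoin u : ~ adjoin A u (0, 1) -> A u.
Proof.
move=> h; apply: (Amax.2 _ (adjoin_alg Aalg h)); first exact: adjoin_sub.
exact: adjoin_mem.
Qed.

(** The domain of a maximal place is a local ring: clearing denominators in an
    expression of [(0, 1)] by the inverse of [v] would put a nonzero value at [0]. *)
Lemma maximal_inv v c : c != 0 -> A (v, c) -> A (v^-1, c^-1).
Proof.
move=> c0 Av; apply: maximal_adjoin => -[p [hp e]].
have v0 : v != 0.
  by apply: contra c0 => /eqP v0; apply/eqP/(place_alg_neq0 Aalg); rewrite -v0.
pose k := size p; pose w : L * K := (v, c); pose u : L * K := (v^-1, c^-1).
have wu : w * u = 1 by rewrite pairM !mulfV.
have : A (w ^+ k * p.[u]).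
  rewrite horner_coef mulr_sumr; apply: place_alg_sum => // i _.
  have -> : w ^+ k = w ^+ (k - i) * w ^+ i by rewrite -exprD subnK // ltnW.
  rewrite mulrCA -mulrA -exprMn wu expr1n mulr1.
  by apply: place_algM => //; exact: place_algX.
rewrite -e.
have -> : w ^+ k * (0, 1) = (0, c ^+ k).
  have -> : w ^+ k = (v ^+ k, c ^+ k).
    by elim: (k) => [|n IH]; rewrite ?expr0 // !exprS IH.
  by rewrite pairM mulr0 mulr1.
move/(place_alg_neq0 Aalg)/eqP; rewrite expf_eq0 => /andP[_].
by rewrite (negPf c0).
Qed.

(** Such a relation says that [1] belongs to the ideal that the kernel of the place
    generates in the extension by [u]. *)
Definition bad_rel (u : L) (k : nat) : Prop :=
  exists p : {poly L}, [/\ A (p`_0, 1), forall i, (0 < i)%N -> A (p`_i, 0),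
    (size p <= k.+1)%N & p.[u] = 0].

(** If no value [c] can be given to [u], the polynomials over [K] that come from
    relations satisfied by [u] have no common root; as [K] is algebraically closed,
    they generate the unit ideal. *)
Lemma bad_rel_exists u : (forall c, ~ A (u, c)) -> exists k, bad_rel u k.
Proof.
move=> nu.
pose f : {rmorphism L * K -> L} := fst.
pose g : {rmorphism L * K -> K} := snd.
(* the values of the relations satisfied by [u], an ideal of [{poly K}] *)
pose J (b : {poly K}) := exists p : {poly L * K},
  [/\ forall i, A p`_i, (map_poly f p).[u] = 0 & b = map_poly g p].
have Jc c : exists2 b, J b & b.[c] = 1.
  have : adjoin A (u, c) (0, 1).
    by apply: contrapT => h; apply: (nu c); exact: maximal_adjoin.
  move=> [p [hp e]]; exists (map_poly g p); last first.
    by rewrite -[c]/(g (u, c)) horner_map -e.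
  by exists p; split=> //; rewrite -[u]/(f (u, c)) horner_map -e.
have JD b b' : J b -> J b' -> J (b + b').
  move=> [p [hp pu ->]] [q [hq qu ->]]; exists (p + q); split.
  - by move=> i; rewrite coefD; exact: place_algD.
  - by rewrite rmorphD hornerD pu qu addr0.
  - by rewrite rmorphD.
have JM b b' : J b -> J (b' * b).
  move=> [p [hp pu ->]].
  pose q : {poly L * K} := \poly_(i < size b') (io b'`_i, b'`_i).
  have hq i : q`_i = (io b'`_i, b'`_i).
    by rewrite coef_poly; case: ltnP => // /leq_sizeP->//; rewrite rmorph0.
  exists (q * p); split.
  - move=> i; rewrite coefM; apply: place_alg_sum => // j _.
    by apply: place_algM => //; rewrite hq; have [] := Aalg.
  - by rewrite rmorphM hornerM pu mulr0.
  - rewrite rmorphM; congr (_ * _); apply/polyP=> i.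
    by rewrite coef_map hq.
have [b [Jb b0 bmin]] : exists b, [/\ J b, b != 0 &
    forall b', J b' -> b' != 0 -> (size b <= size b')%N].
  pose Q n := `[< exists b, [/\ J b, b != 0 & size b = n] >].
  have exQ : exists n, Q n.
    have [b Jb b1] := Jc 0; exists (size b); apply/asboolP; exists b; split=> //.
    by apply/eqP=> b0; move: b1; rewrite b0 horner0 => /esym/eqP; rewrite oner_eq0.
  case: (ex_minnP exQ) => n /asboolP[b [Jb b0 sb]] nmin.
  exists b; split=> // b' Jb' b'0; rewrite sb; apply: nmin; apply/asboolP.
  by exists b'.
have sb : size b = 1.
  apply/eqP; apply: contraT => /closed_rootP[c cb].
  have [b' Jb' b'c] := Jc c.
  have Jm : J (b' %% b).
    have -> : b' %% b = b' + (- (b' %/ b)) * b.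
      by rewrite {2}(divp_eq b' b) mulNr addrAC subrr add0r.
    by apply: JD => //; exact: JM.
  have m0 : b' %% b = 0.
    apply/eqP; apply: contraT => /(bmin _ Jm); rewrite leqNgt ltn_modp b0 //.
  move: b'c; rewrite (divp_eq b' b) m0 addr0 hornerM (rootP cb) mulr0.
  by move/esym/eqP; rewrite oner_eq0.
have [p [hp pu p1]] : J 1.
  have -> : 1 = (b`_0)^-1%:P * b.
    rewrite {2}(size1_polyC (eq_leq sb)) -polyCM mulVf //.
    by apply: contra b0 => /eqP b00; rewrite (size1_polyC (eq_leq sb)) b00.
  exact: JM.
have ph i : A ((map_poly f p)`_i, (map_poly g p)`_i).
  by rewrite !coef_map -surjective_pairing.
exists (size (map_poly f p)), (map_poly f p); split=> //.
- by have := ph 0%N; rewrite -p1 coef1.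
- by move=> i i0; have := ph i; rewrite -p1 coef1 eqn0Ngt i0.
Qed.

(** The constant coefficient of the relation for the inverse of [u] is a unit, so
    that this relation expresses a power of [u] by lower powers, and lowers the
    degree of the relation for [u]. *)
Lemma bad_rel_step u k l : u != 0 -> (l <= k)%N ->
  bad_rel u k -> bad_rel u^-1 l -> (0 < k)%N /\ bad_rel u k.-1.
Proof.
move=> u0 lk [p [p1 p0 sp pu]] [q [q1 q0 sq qu]].
have l0 : (0 < l)%N.
  case: l {lk} sq => // sq; move: qu; rewrite (size1_polyC sq) hornerC => q00.
  by have [_ _ _ []] := Aalg; rewrite -q00.
have k0 : (0 < k)%N by exact: leq_trans lk.
split=> //.
have qn0 : q`_0 != 0.
  by apply/negP=> /eqP q00; have [_ _ _ []] := Aalg; rewrite -q00.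
have qV : A ((q`_0)^-1, 1) by rewrite -(invr1 K); exact: maximal_inv (oner_neq0 _) q1.
have pk : A (p`_k / q`_0, 0).
  by have := place_algM Aalg (p0 _ k0) qV; rewrite pairM mul0r.
(* [u ^ k] times the relation for the inverse of [u] *)
pose r : {poly L} := \poly_(j < k.+1) q`_(k - j).
have ru : r.[u] = 0.
  have sqk : (size q <= k.+1)%N by exact: leq_trans sq _.
  have : u ^+ k * q.[u^-1] = 0 by rewrite qu mulr0.
  rewrite (horner_coef_wide _ sqk) mulr_sumr => <-.
  rewrite horner_poly (reindex_inj rev_ord_inj) /=; apply: eq_bigr => i _.
  have ik : (i <= k)%N by rewrite -ltnS.
  rewrite subSS (subKn ik) mulrCA; congr (_ * _).
  have -> : u ^+ k = u ^+ (k - i) * u ^+ i by rewrite -exprD subnK.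
  by rewrite -mulrA -exprMn mulfV // expr1n mulr1.
have cr i : A (p`_k / q`_0 * r`_i, 0).
  rewrite coef_poly; case: ltnP => _; last first.
    by rewrite mulr0; exact: place_alg0.
  have [c qc] : exists c, A (q`_(k - i), c).
    by case: (k - i)%N => [|n]; [exists 1|exists 0; exact: q0].
  by have := place_algM Aalg pk qc; rewrite pairM mul0r.
have sub i c : A (p`_i, c) -> A ((p - (p`_k / q`_0) *: r)`_i, c).
  move=> Ap; rewrite coefB coefZ.
  by have := place_algD Aalg Ap (place_algN Aalg (cr i)); rewrite pairN pairD oppr0 addr0.
exists (p - (p`_k / q`_0) *: r); split.
- exact: sub.
- by move=> i i0; apply/sub/p0.
- rewrite prednK //; apply/leq_sizeP => j kj.
  rewrite coefB coefZ coef_poly; move: kj; rewrite leq_eqVlt => /orP[/eqP<-|kj].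
    by rewrite leqnn subnn divfK // subrr.
  rewrite [(j < _)%N]ltnNge kj /= mulr0 subr0.
  by apply: nth_default; exact: leq_trans kj.
- by rewrite hornerD hornerN hornerZ pu ru mulr0 subrr.
Qed.

Lemma bad_rel_false u : u != 0 -> forall k l, bad_rel u k -> bad_rel u^-1 l -> False.
Proof.
move=> u0 k l; move: {2}(k + l)%N (leqnn (k + l)) => n.
elim: n k l => [|n IH] k l kln bk bl.
  move: kln; rewrite leqn0 addn_eq0 => /andP[/eqP k0 /eqP l0]; subst k l.
  by have [] := bad_rel_step u0 (leqnn 0) bk bl.
have [lk|/ltnW kl] := leqP l k.
  have [k0 bk'] := bad_rel_step u0 lk bk bl.
  apply: IH bk' bl; move: k0 kln; clear; lia.
have bk2 : bad_rel u^-1^-1 k by rewrite invrK.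
have uV : u^-1 != 0 by rewrite invr_eq0.
have [l0 bl'] := bad_rel_step uV kl bl bk2.
by apply: IH bk bl'; move: l0 kln; clear; lia.
Qed.

(** A maximal place is defined on a valuation ring. *)
Lemma maximal_total u : (exists c, A (u, c)) \/ (exists c, A (u^-1, c)).
Proof.
apply: contrapT => /not_orP[/forallNP h1 /forallNP h2].
have u0 : u != 0.
  by apply/negP=> /eqP u0; apply: (h1 0); rewrite u0; exact: place_alg0.
have [k bk] := bad_rel_exists h1; have [l bl] := bad_rel_exists h2.
exact: bad_rel_false u0 _ _ bk bl.
Qed.

End Maximal.

(** A nonconstant function has a pole: it is transcendental over the algebraically
    closed field [K], so sending its inverse to [0] defines a morphism on the
    algebra that this inverse generates. *)
Lemma place_pole f : (forall c, f <> io c) ->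
  exists A, maximal_alg A /\ A (f^-1, 0).
Proof.
move=> fc.
pose G : set (L * K) := [set v | exists q : {poly K}, v = ((map_poly io q).[f^-1], q.[0])].
have Galg : place_alg G.
  split.
  - by move=> c; exists c%:P; rewrite map_polyC !hornerC.
  - by move=> _ _ [p ->] [q ->]; exists (p + q); rewrite rmorphD !hornerD.
  - by move=> _ _ [p ->] [q ->]; exists (p * q); rewrite rmorphM !hornerM.
  - move=> [q [q0 q1]].
    have [r qr] := closed_field_poly_normal q.
    have lq0 : lead_coef q != 0.
      rewrite lead_coef_eq0; apply/negP => /eqP q00.
      by move/eqP: q1; rewrite q00 horner0 oner_eq0.
    move: q0; rewrite qr map_polyZ hornerZ rmorph_prod horner_prod.
    move/esym/eqP; rewrite mulf_eq0 fmorph_eq0 (negPf lq0) /=.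
    rewrite prodf_seq_eq0 => /hasP[z zr /= ]; rewrite rmorphB /= map_polyX map_polyC.
    rewrite hornerXsubC subr_eq0 => /eqP fz.
    apply: (fc z^-1); rewrite fmorphV -fz invrK //.
have [A [Amax GA]] := maximal_alg_exists Galg.
exists A; split=> //; apply: GA; exists 'X.
by rewrite map_polyX !hornerX.
Qed.

End Places.

(** * Hilbert's basis theorem *)

Definition lin_span (R : comNzRingType) (u : nat -> R) (n : nat) (x : R) : Prop :=
  exists c : nat -> R, x = \sum_(i < n) c i * u i.

(** The ascending chain condition, stated for sequences of generators. *)
Definition noeth (R : comNzRingType) : Prop :=
  forall u : nat -> R, exists n, lin_span u n (u n).

Section LinSpan.
Variables (R : comNzRingType) (u : nat -> R).

Lemma lin_span0 n : lin_span u n 0.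
Proof. by exists (fun=> 0); rewrite big1 // => i _; rewrite mul0r. Qed.

Lemma lin_span_lin n a x y : lin_span u n x -> lin_span u n y -> lin_span u n (a * x + y).
Proof.
move=> [c ->] [d ->]; exists (fun i => a * c i + d i).
rewrite mulr_sumr -big_split; apply: eq_bigr => i _ /=.
by rewrite mulrDl mulrA.
Qed.

Lemma lin_span_sum n m (c v : nat -> R) :
  (forall i, (i < m)%N -> lin_span u n (v i)) -> lin_span u n (\sum_(i < m) c i * v i).
Proof.
move=> h; elim: m h => [|m IH] h; first by rewrite big_ord0; exact: lin_span0.
rewrite big_ord_recr /= addrC; apply: lin_span_lin; first exact: h.
by apply: IH => i im; apply: h; exact: ltnW.
Qed.

Lemma lin_span_mem n i : (i < n)%N -> lin_span u n (u i).
Proof.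
move=> im; exists (fun j => (j == i)%:R); rewrite (bigD1 (Ordinal im)) //= eqxx.
rewrite mul1r big1 ?addr0 // => j /eqP ji.
case: eqP => [e|_]; last by rewrite mul0r.
by case: ji; apply: val_inj.
Qed.

Lemma lin_span_le n m x : (n <= m)%N -> lin_span u n x -> lin_span u m x.
Proof.
move=> nm [c ->]; apply: lin_span_sum => i ik; apply: lin_span_mem; exact: leq_trans nm.
Qed.

End LinSpan.

Lemma noeth_field (K : fieldType) : noeth K.
Proof.
move=> u; have [u0|u0] := eqVneq (u 0%N) 0.
  by exists 0%N; rewrite u0; exact: lin_span0.
exists 1%N, (fun=> u 1%N / u 0%N).
by rewrite big_ord1 divfK.
Qed.

Lemma noeth_surj (R S : comNzRingType) (f : {rmorphism R -> S}) :
  (forall y, exists x, f x = y) -> noeth R -> noeth S.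
Proof.
move=> /choice[g gK] nR u; have [n [c e]] := nR (g \o u).
exists n, (f \o c); rewrite -[LHS]gK -[g _]/((g \o u) n) e rmorph_sum.
by apply: eq_bigr => i _; rewrite rmorphM /= gK.
Qed.

Section HilbertBasis.
Variables (R : comNzRingType) (nR : noeth R).

(** For an ideal that no finite list generates, elements of least degree outside
    the span of the previous ones. *)
Lemma greedy_sequence (J : set {poly R}) :
  (forall (f : nat -> {poly R}) n, (forall i, (i < n)%N -> J (f i)) ->
     exists2 p, J p & ~ lin_span f n p) ->
  exists f : nat -> {poly R}, forall n, [/\ J (f n), ~ lin_span f n (f n) &
    forall p, J p -> ~ lin_span f n p -> (size (f n) <= size p)%N].
Proof.
move=> hJ.
have hs (s : seq {poly R}) : exists p, (forall i, (i < size s)%N -> J s`_i) ->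
    [/\ J p, ~ lin_span (nth 0 s) (size s) p &
    forall q, J q -> ~ lin_span (nth 0 s) (size s) q -> (size p <= size q)%N].
  case: (pselect (forall i, (i < size s)%N -> J s`_i)) => [h|h]; last by exists 0.
  pose Q n := `[< exists p, [/\ J p, ~ lin_span (nth 0 s) (size s) p & size p = n] >].
  have exQ : exists n, Q n.
    have [p Jp sp] := hJ _ _ h.
    by exists (size p); apply/asboolP; exists p.
  case: (ex_minnP exQ) => n /asboolP[p [Jp np sp]] nmin.
  exists p => _; split=> // q Jq nq; rewrite sp; apply: nmin; apply/asboolP.
  by exists q.
have [next hnext] := choice hs.
pose F := fix F n := if n is m.+1 then rcons (F m) (next (F m)) else [::].
have sF n : size (F n) = n by elim: n => //= n IH; rewrite size_rcons IH.
pose f n := next (F n).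
have fF n i : (i < n)%N -> (F n)`_i = f i.
  elim: n => // n IH; rewrite ltnS leq_eqVlt /= nth_rcons sF => /orP[/eqP->|ni].
    by rewrite ltnn eqxx.
  by rewrite ni IH.
have spanF n p : lin_span (nth 0 (F n)) (size (F n)) p <-> lin_span f n p.
  rewrite sF; split=> -[c ->]; exists c; apply: eq_bigr => i _;
    by rewrite fF.
have Jf n : J (f n).
  have [m nm] := ubnP n; elim: m n nm => // m IH n nm.
  have [|//] := hnext (F n); move=> i; rewrite sF => i_n.
  by rewrite fF //; apply: IH; exact: leq_trans i_n _.
exists f => n.
have [|h1 h2 h3] := hnext (F n).
  by move=> i; rewrite sF => i_n; rewrite fF.
split=> //; first by move/spanF.
by move=> p Jp np; apply: h3 => // /spanF.
Qed.

(** The leading coefficients of the greedy sequence satisfy a linear relation over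
    [R], which lowers the degree of one member modulo the previous ones. *)
Lemma noeth_poly : noeth {poly R}.
Proof.
move=> u; apply: contrapT => /forallNP nu.
pose J : set {poly R} := [set p | exists n, lin_span u n p].
have Jlin a x y : J x -> J y -> J (a * x + y).
  move=> [n nx] [m my]; exists (maxn n m); apply: lin_span_lin.
    by apply: lin_span_le nx; exact: leq_maxl.
  by apply: lin_span_le my; exact: leq_maxr.
have Jfin (f : nat -> {poly R}) n : (forall i, (i < n)%N -> J (f i)) ->
    exists N, forall i, (i < n)%N -> lin_span u N (f i).
  elim: n => [|n IH] h; first by exists 0%N.
  have [N hN] := IH (fun i lt => h i (ltnW lt)).
  have [M hM] := h n (ltnSn n).
  exists (maxn N M) => i; rewrite ltnS leq_eqVlt => /orP[/eqP->|/hN hi].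
    by apply: lin_span_le hM; exact: leq_maxr.
  by apply: lin_span_le hi; exact: leq_maxl.
have [|f hf] := @greedy_sequence J.
  move=> f n hn; apply: contrapT => h.
  have [N hN] := Jfin f n hn.
  apply: (nu N).
  have [c ->] : lin_span f n (u N).
    apply: contrapT => h'; apply: h; exists (u N) => //.
    by exists N.+1; exact: lin_span_mem.
  exact: lin_span_sum.
have [n [r e]] := nR (fun i => lead_coef (f i)).
have [Jn nn minn_] := hf n.
have szle i : (i < n)%N -> (size (f i) <= size (f n))%N.
  move=> i_n; have [_ _ h] := hf i; apply: h => // /(lin_span_le (ltnW i_n)).
  exact: nn.
pose g := \sum_(i < n) (r i *: 'X^(size (f n) - size (f i))) * f i.
have sg : lin_span f n g.
  by exists (fun i => r i *: 'X^(size (f n) - size (f i))).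
have Jg m : J (\sum_(i < m) (r i *: 'X^(size (f n) - size (f i))) * f i).
  elim: m => [|m IH]; first by rewrite big_ord0; exists 0%N; exact: lin_span0.
  by rewrite big_ord_recr /= addrC; apply: Jlin => //; have [] := hf m.
have nfg : ~ lin_span f n (f n - g).
  by move=> h; apply: nn; rewrite -(subrK g (f n)) -[_ - g]mul1r; exact: lin_span_lin.
have Jfg : J (f n - g) by rewrite addrC -mulN1r; apply: Jlin => //; exact: Jg.
have := minn_ _ Jfg nfg; apply/negP; rewrite -ltnNge.
have fn0 : (0 < size (f n))%N.
  rewrite lt0n size_poly_eq0; apply/negP=> /eqP fn0; apply: nn; rewrite fn0.
  exact: lin_span0.
rewrite -(prednK fn0) ltnS; apply/leq_sizeP => j hj.
have cg i : (i < n)%N -> ((r i *: 'X^(size (f n) - size (f i))) * f i)`_j =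
    if j == (size (f n)).-1 then r i * lead_coef (f i) else 0.
  move=> i_n; rewrite -scalerAl coefZ coefXnM.
  have sfi : (0 < size (f i))%N.
    rewrite lt0n size_poly_eq0; apply/negP=> /eqP fi0.
    by have [_ h _] := hf i; apply: h; rewrite fi0; exact: lin_span0.
  have := szle i i_n.
  case: eqP => [->|/eqP jn] le.
    have -> : ((size (f n)).-1 < size (f n) - size (f i))%N = false by lia.
    rewrite lead_coefE; congr (_ * _`__); lia.
  have jn' : (size (f n) <= j)%N.
    by rewrite -(prednK fn0) ltn_neqAle eq_sym jn hj.
  have -> : (j < size (f n) - size (f i))%N = false by lia.
  rewrite nth_default ?mulr0 //; move: le jn'; clear.
  by move: (size (f i)) (size (f n)) => a b; lia.
rewrite coefB coef_sum (eq_bigr _ (fun (i : 'I_n) _ => cg i (ltn_ord i))).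
case: eqP => [->|/eqP jn]; first by rewrite -lead_coefE e subrr.
rewrite big1 ?subr0 // nth_default //.
by rewrite -(prednK fn0) ltn_neqAle eq_sym jn hj.
Qed.

End HilbertBasis.

Lemma mpoly_ring_ind (R : comNzRingType) n (P : {mpoly R[n]} -> Prop) :
  (forall c, P c%:MP) -> (forall i, P 'X_i) ->
  (forall p q, P p -> P q -> P (p + q)) ->
  (forall p q, P p -> P q -> P (p * q)) -> forall p, P p.
Proof.
move=> hC hX hD hM; elim/mpolyind => [|c m p _ _ hp]; first by rewrite -mpolyC0.
apply: (hD) => //; rewrite -mul_mpolyC; apply: (hM) => //.
rewrite mpolyXE_id; apply: (big_ind P) => //; first by rewrite -mpolyC1.
move=> i _; elim: (m i) => [|k IH]; first by rewrite expr0 -mpolyC1.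
by rewrite exprS; exact: hM.
Qed.

Lemma noeth_mpoly (K : fieldType) n : noeth {mpoly K[n]}.
Proof.
elim: n => [|n IH].
  apply: (@noeth_surj K {mpoly K[0]} (@mpolyC 0 K)); last exact: noeth_field.
  elim/mpoly_ring_ind => [c|[]//|p q [a <-] [b <-]|p q [a <-] [b <-]].
  - by exists c.
  - by exists (a + b); rewrite rmorphD.
  - by exists (a * b); rewrite rmorphM.
pose f : {rmorphism {poly {mpoly K[n]}} -> {mpoly K[n.+1]}} :=
  horner_eval ('X_ord_max : {mpoly K[n.+1]}) \o map_poly (@mwiden n K).
apply: (@noeth_surj _ _ f); last exact: noeth_poly.
elim/mpoly_ring_ind => [c|i|p q [a <-] [b <-]|p q [a <-] [b <-]].
- exists (c%:MP)%:P; rewrite /f /= map_polyC /= /horner_eval hornerC.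
  exact: mwidenC.
- have [->|] := eqVneq i ord_max.
    by exists 'X; rewrite /f /= map_polyX /horner_eval hornerX.
  move=> im; have [j ->] : exists j : 'I_n, i = widen_ord (leqnSn n) j.
    have i_n : (i < n)%N by rewrite ltn_neqAle -ltnS ltn_ord andbT.
    by exists (Ordinal i_n); apply: val_inj.
  exists ('X_j)%:P; rewrite /f /= map_polyC /= /horner_eval hornerC.
  by rewrite mwidenX mnmwiden1.
- by exists (a + b); rewrite rmorphD.
- by exists (a * b); rewrite rmorphM.
Qed.

(** * Polynomials: evaluation, differentials, substitution *)

Section MmapRules.
Variables (K : comNzRingType) (S : comNzRingType) (f : {rmorphism K -> S}) (n : nat).

Lemma mmap_X (h : 'I_n -> S) i : mmap f h 'X_i = h i.
Proof. by rewrite mmapX mmap1U. Qed.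

Lemma mmap_homog_scale (h : 'I_n -> S) (c : S) d (F : {mpoly K[n]}) :
  F \is d.-homog -> mmap f (fun i => c * h i) F = c ^+ d * mmap f h F.
Proof.
move=> /dhomogP hF; rewrite /mmap mulr_sumr !big_seq; apply: eq_bigr => m mF.
rewrite mulrCA; congr (_ * _); rewrite /mmap1.
under eq_bigr do rewrite exprMn.
by rewrite big_split /= prodrXr -mdegE (hF _ mF).
Qed.

Lemma mmap_ext (h h' : 'I_n -> S) (F : {mpoly K[n]}) :
  h =1 h' -> mmap f h F = mmap f h' F.
Proof.
move=> hh; rewrite /mmap; apply: eq_bigr => m _; congr (_ * _).
exact: mmap1_eq.
Qed.

End MmapRules.

Lemma mmap_comp (K S U : comNzRingType) (f : {rmorphism K -> S})
    (g : {rmorphism S -> U}) n (h : 'I_n -> S) (F : {mpoly K[n]}) :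
  g (mmap f h F) = mmap (g \o f) (g \o h) F.
Proof.
rewrite /mmap rmorph_sum; apply: eq_bigr => m _; rewrite rmorphM /=.
congr (_ * _); rewrite /mmap1 rmorph_prod; apply: eq_bigr => i _.
by rewrite rmorphXn.
Qed.

Lemma morph_mmap (K S : comNzRingType) n (g : {rmorphism {mpoly K[n]} -> S})
    (F : {mpoly K[n]}) :
  g F = mmap (g \o @mpolyC n K) (fun i => g 'X_i) F.
Proof.
elim/mpoly_ring_ind: F => [c|i|p q hp hq|p q hp hq].
- by rewrite mmapC.
- by rewrite mmap_X.
- by rewrite mmapD rmorphD hp hq.
- by rewrite !rmorphM /= hp hq.
Qed.

Section EvalRules.
Variables (K : fieldType) (n : nat).
Implicit Types (F G : {mpoly K[n]}) (x w : 'rV[K]_n).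

Lemma evalD F G x : eval_at (F + G) x = eval_at F x + eval_at G x.
Proof. exact: mevalD. Qed.

Lemma evalB F G x : eval_at (F - G) x = eval_at F x - eval_at G x.
Proof. exact: mevalB. Qed.

Lemma evalM F G x : eval_at (F * G) x = eval_at F x * eval_at G x.
Proof. exact: mevalM. Qed.

Lemma evalE F k x : eval_at (F ^+ k) x = eval_at F x ^+ k.
Proof. by rewrite /eval_at rmorphXn. Qed.

Lemma evalC c x : eval_at c%:MP x = c.
Proof. exact: mevalC. Qed.

Lemma eval0 x : eval_at 0 x = 0.
Proof. exact: meval0. Qed.

Lemma eval1 x : eval_at 1 x = 1.
Proof. exact: meval1. Qed.

Lemma evalX i x : eval_at 'X_i x = x ord0 i.
Proof. exact: mevalXU. Qed.

Lemma eval_sum I (r : seq I) (P : pred I) (F : I -> {mpoly K[n]}) x :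
  eval_at (\sum_(i <- r | P i) F i) x = \sum_(i <- r | P i) eval_at (F i) x.
Proof. exact: raddf_sum. Qed.

Lemma eval_homog_scale c d F x : F \is d.-homog ->
  eval_at F (c *: x) = c ^+ d * eval_at F x.
Proof.
move=> hF; rewrite /eval_at /meval -(mmap_homog_scale _ _ _ hF).
by apply: mmap_ext => i; rewrite mxE.
Qed.

Lemma diffD F G x w : diff_at (F + G) x w = diff_at F x w + diff_at G x w.
Proof.
rewrite /diff_at -big_split; apply: eq_bigr => i _ /=.
by rewrite mderivD evalD mulrDl.
Qed.

Lemma diffM F G x w :
  diff_at (F * G) x w = diff_at F x w * eval_at G x + eval_at F x * diff_at G x w.
Proof.
rewrite /diff_at mulr_suml mulr_sumr -big_split; apply: eq_bigr => i _ /=.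
by rewrite mderivM evalD !evalM mulrDl mulrAC mulrA.
Qed.

Lemma diffC c x w : diff_at c%:MP x w = 0.
Proof. by rewrite /diff_at big1 // => i _; rewrite mderivC eval0 mul0r. Qed.

Lemma diffB F G x w : diff_at (F - G) x w = diff_at F x w - diff_at G x w.
Proof. by rewrite diffD -[- G]mulN1r -mpolyC1 -mpolyCN diffM diffC mul0r add0r evalC mulN1r. Qed.

Lemma mderiv_X (i j : 'I_n) : ('X_j : {mpoly K[n]})^`M(i) = (i == j)%:R.
Proof.
rewrite mderivX mnm1E eq_sym; case: eqP => [->|_]; last by rewrite scale0r.
have -> : (U_(j) - U_(j))%MM = 0%MM by apply/mnmP=> k; rewrite mnmBE mnm0E subnn.
by rewrite mpolyX0 scale1r.
Qed.

Lemma eval_nat x k : eval_at k%:R x = k%:R.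
Proof. by rewrite /eval_at rmorph_nat. Qed.

Lemma diffX i x w : diff_at 'X_i x w = w ord0 i.
Proof.
rewrite /diff_at (bigD1 i) //= mderiv_X eqxx eval_nat mul1r big1 ?addr0 //.
by move=> j /negPf ji; rewrite mderiv_X ji eval_nat mul0r.
Qed.

Lemma diff_lin F x a w w' :
  diff_at F x (a *: w + w') = a * diff_at F x w + diff_at F x w'.
Proof.
rewrite /diff_at mulr_sumr -big_split; apply: eq_bigr => i _ /=.
by rewrite !mxE mulrDr mulrCA.
Qed.

Lemma diff_sum I (r : seq I) (P : pred I) (F : I -> {mpoly K[n]}) x w :
  diff_at (\sum_(i <- r | P i) F i) x w = \sum_(i <- r | P i) diff_at (F i) x w.
Proof.
apply: (big_morph (fun F => diff_at F x w)) => [F1 F2|]; first exact: diffD.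
by rewrite -mpolyC0 diffC.
Qed.

(** Hadamard's lemma; the values of the coefficients turn equations of the curve
    into linear conditions on the coordinate differences. *)
Lemma hadamard F y : exists c : 'I_n -> {mpoly K[n]},
  F = (eval_at F y)%:MP + \sum_k c k * ('X_k - (y ord0 k)%:MP) /\
  forall k, eval_at (c k) y = eval_at F^`M(k) y.
Proof.
suff [c hc] : exists c : 'I_n -> {mpoly K[n]},
    F = (eval_at F y)%:MP + \sum_k c k * ('X_k - (y ord0 k)%:MP).
  exists c; split=> // k; rewrite [in RHS]hc mderivD mderivC add0r.
  rewrite raddf_sum eval_sum (bigD1 k) //= mderivM mderivB mderivC mderiv_X.
  rewrite eqxx subr0 evalD !evalM evalB evalX evalC subrr mulr0 add0r eval1 mulr1.
  rewrite big1 ?addr0 // => j /negPf jk.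
  rewrite mderivM mderivB mderivC mderiv_X eq_sym jk subr0 mulr0 addr0.
  by rewrite evalM evalB evalX evalC subrr mulr0.
elim/mpoly_ring_ind: F => [c|i|p q [c hp] [d hq]|p q [c hp] [d hq]].
- exists (fun=> 0); rewrite big1 ?addr0 ?evalC // => k _; exact: mul0r.
- exists (fun k => (k == i)%:R); rewrite (bigD1 i) //= eqxx mul1r evalX.
  rewrite big1 ?addr0 1?addrC ?subrK // => k /negPf ->; exact: mul0r.
- exists (fun k => c k + d k); rewrite {1}hp {1}hq evalD mpolyCD.
  under [X in _ = _ + X]eq_bigr do rewrite mulrDl.
  by rewrite big_split /= addrACA.
- exists (fun k => c k * q + (eval_at p y)%:MP * d k).
  pose m (k : 'I_n) := 'X_k - (y ord0 k)%:MP.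
  have -> : \sum_k (c k * q + (eval_at p y)%:MP * d k) * m k =
      (\sum_k c k * m k) * q + (eval_at p y)%:MP * \sum_k d k * m k.
    rewrite mulr_suml mulr_sumr -big_split; apply: eq_bigr => k _ /=.
    by rewrite mulrDl mulrAC mulrA.
  have -> : \sum_k c k * m k = p - (eval_at p y)%:MP by rewrite {1}hp addrC addKr.
  have -> : \sum_k d k * m k = q - (eval_at q y)%:MP by rewrite {1}hq addrC addKr.
  by rewrite evalM mpolyCM; ring.
Qed.

End EvalRules.

Definition subst (K : fieldType) n (Z : 'I_n -> {poly K}) (F : {mpoly K[n]}) :
  {poly K} := mmap (@polyC K) Z F.

Section Subst.
Variables (K : fieldType) (n : nat) (Z : 'I_n -> {poly K}).
Implicit Types (F G : {mpoly K[n]}).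

Definition curve_at (t : K) : 'rV[K]_n := \row_i (Z i).[t].
Definition velocity_at (t : K) : 'rV[K]_n := \row_i ((Z i)^`()).[t].

Lemma horner_subst F t : (subst Z F).[t] = eval_at F (curve_at t).
Proof.
elim/mpoly_ring_ind: F => [c|i|p q hp hq|p q hp hq].
- by rewrite /subst mmapC hornerC evalC.
- by rewrite /subst mmap_X evalX mxE.
- by rewrite /subst mmapD hornerD evalD -hp -hq.
- by rewrite /subst rmorphM hornerM evalM -hp -hq.
Qed.

Lemma deriv_subst F :
  (subst Z F)^`() = \sum_i subst Z F^`M(i) * (Z i)^`().
Proof.
elim/mpoly_ring_ind: F => [c|i|p q hp hq|p q hp hq].
- rewrite /subst mmapC derivC big1 // => i _.
  by rewrite mderivC mmap0 mul0r.
- rewrite /subst mmap_X (bigD1 i) //= mderiv_X eqxx.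
  rewrite rmorph_nat mul1r big1 ?addr0 // => j /negPf ji.
  by rewrite mderiv_X ji rmorph_nat mul0r.
- have sD a b : subst Z (a + b) = subst Z a + subst Z b by exact: mmapD.
  rewrite sD derivD hp hq -big_split; apply: eq_bigr => i _ /=.
  by rewrite mderivD sD mulrDl.
- have sM a b : subst Z (a * b) = subst Z a * subst Z b by exact: rmorphM.
  have sD a b : subst Z (a + b) = subst Z a + subst Z b by exact: mmapD.
  rewrite sM derivM hp hq mulr_suml mulr_sumr -big_split; apply: eq_bigr => i _ /=.
  by rewrite mderivM sD !sM mulrDl mulrAC mulrA.
Qed.

Lemma horner_deriv_subst F t :
  (subst Z F)^`().[t] = diff_at F (curve_at t) (velocity_at t).
Proof.
rewrite deriv_subst horner_sum /diff_at; apply: eq_bigr => i _.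
by rewrite hornerM horner_subst mxE.
Qed.

End Subst.

(** Euler's relation, by differentiating along the line through the origin. *)
Lemma euler (K : fieldType) n d (F : {mpoly K[n]}) (x : 'rV[K]_n) :
  F \is d.-homog -> diff_at F x x = d%:R * eval_at F x.
Proof.
move=> hF; pose Z (i : 'I_n) : {poly K} := 'X * (x ord0 i)%:P.
have cx : curve_at Z 1 = x.
  by apply/rowP=> i; rewrite mxE hornerM hornerX hornerC mul1r.
have vx : velocity_at Z 1 = x.
  by apply/rowP=> i; rewrite mxE derivM derivX derivC mulr0 addr0 mul1r hornerC.
have := horner_deriv_subst Z F 1; rewrite cx vx => <-.
have -> : subst Z F = 'X^d * (eval_at F x)%:P.
  rewrite /subst (mmap_homog_scale _ _ _ hF); congr (_ * _).
  by rewrite /eval_at /meval mmap_comp.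
rewrite derivM derivC mulr0 addr0 derivXn hornerM hornerC hornerMn hornerXn.
by rewrite expr1n.
Qed.

(** The set may be infinite, such as the set of the differentials of all the
    equations of the curve; the rank bounds the number of rows. *)
Lemma independent_rows (F : fieldType) n (S : set 'rV[F]_n) :
  exists m (A : 'M[F]_(m, n)), [/\ row_free A, forall i, S (row i A) &
    forall s, S s -> (s <= A)%MS].
Proof.
pose P m := `[< exists A : 'M[F]_(m, n), row_free A /\ forall i, S (row i A) >].
have P0 : exists m, P m.
  exists 0%N; apply/asboolP; exists 0; split=> [|[]//].
  by rewrite /row_free mxrank0.
have Pn m : P m -> (m <= n)%N.
  move=> /asboolP[A [/eqP rA _]]; rewrite -[X in (X <= _)%N]rA; exact: rank_leq_col.
case: (ex_maxnP P0 Pn) => m /asboolP[A [Af AS]] mmax.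
exists m, A; split=> // s Ss; apply: contraT => sA.
have : P (m + 1)%N.
  apply/asboolP; exists (col_mx A s); split.
    rewrite /row_free eqn_leq rank_leq_row /= -addsmxE addn1.
    move/eqP: (Af) => rA; rewrite -[X in (X < _)%N]rA; apply: rank_ltmx.
    by rewrite /ltmx addsmxSl addsmx_sub submx_refl.
  move=> i; case: (split_ordP i) => j ->; rewrite ?rowKu ?rowKd //.
  by rewrite [row j s](_ : _ = s) //; apply/rowP=> k; rewrite mxE ord1.
by move/mmax; rewrite addn1 ltnn.
Qed.

(** * An affine chart of the curve *)

Lemma proj_closed_scale (K : fieldType) n (Y : set 'rV[K]_n) c x :
  proj_closed Y -> c != 0 -> Y x -> Y (c *: x).
Proof.
move=> [S [hS ->]] c0 [x0 hx]; split; first by rewrite scaler_eq0 negb_or c0.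
by move=> F SF; have [d hd] := hS _ SF; rewrite (eval_homog_scale _ _ hd) hx ?mulr0.
Qed.

Section Chart.
Variables (K : numClosedFieldType) (n : nat) (X : set 'rV[K]_n).
Implicit Types (F G : {mpoly K[n]}) (x y u v w : 'rV[K]_n).
Hypothesis Xcurve : smooth_projective_curve X.

Let Xclosed : proj_closed X. Proof. by case: Xcurve. Qed.
Let Xirr : proj_irreducible X. Proof. by case: Xcurve. Qed.

Lemma curve_neq0 x : X x -> x != 0.
Proof. by have [S [_ ->]] := Xclosed => -[]. Qed.

Lemma curve_scale c x : c != 0 -> X x -> X (c *: x).
Proof. exact: proj_closed_scale. Qed.

Lemma proj_closed1 (F : {mpoly K[n]}) : homogeneous F ->
  proj_closed [set x | x != 0 /\ eval_at F x = 0].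
Proof.
move=> hF; exists [set F]; split=> [_ ->//|]; apply/seteqP; split=> x [x0 hx].
  by split=> // _ ->.
by split=> //; exact: hx.
Qed.

Lemma curve_prime (F G : {mpoly K[n]}) : homogeneous F -> homogeneous G ->
  (forall x, X x -> eval_at F x = 0 \/ eval_at G x = 0) ->
  (forall x, X x -> eval_at F x = 0) \/ (forall x, X x -> eval_at G x = 0).
Proof.
move=> hF hG h; have [_ irr] := Xirr.
have [|s|s] := irr _ _ (proj_closed1 hF) (proj_closed1 hG).
- move=> x Xx; have x0 := curve_neq0 Xx.
  by have [Fx|Gx] := h _ Xx; [left|right].
- by left=> x /s[].
- by right=> x /s[].
Qed.

Variable i0 : 'I_n.
Hypothesis Xi0 : exists2 u, X u & u ord0 i0 != 0.

Definition chart : set 'rV[K]_n := [set x | X x /\ x ord0 i0 = 1].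

Definition vanishes (F : {mpoly K[n]}) : Prop :=
  forall y, chart y -> eval_at F y = 0.

Lemma chart_scale x : X x -> x ord0 i0 != 0 -> chart ((x ord0 i0)^-1 *: x).
Proof.
move=> Xx xi; split; last by rewrite mxE mulVf.
by apply: curve_scale => //; rewrite invr_eq0.
Qed.

Lemma chart_nonempty : exists y, chart y.
Proof.
by have [u Xu ui] := Xi0; exists ((u ord0 i0)^-1 *: u); exact: chart_scale.
Qed.

Definition homogenize (F : {mpoly K[n]}) : {mpoly K[n]} :=
  \sum_(k < msize F) pihomog mdeg k F * 'X_i0 ^+ (msize F - k).

Lemma homogenize_homog F : homogenize F \is (msize F).-homog.
Proof.
apply: rpred_sum => k _.
have e : msize F = (k + (msize F - k))%N by rewrite subnKC // ltnW.
suff : pihomog mdeg k F * 'X_i0 ^+ (msize F - k) \is (k + (msize F - k)).-homog.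
  by rewrite -e.
apply: dhomogM; first exact: pihomogP.
have X1 : ('X_i0 : {mpoly K[n]}) \is 1.-homog by rewrite dhomogX /= mdeg1.
by have := dhomogMn (msize F - k) X1; rewrite mul1n.
Qed.

Lemma msize_partition (F : {mpoly K[n]}) : F = \sum_(k < msize F) pihomog mdeg k F.
Proof. exact: pihomog_partitionE. Qed.

Lemma eval_homogenize F x : x ord0 i0 = 1 ->
  eval_at (homogenize F) x = eval_at F x.
Proof.
move=> xi; rewrite [in RHS](msize_partition F) !eval_sum; apply: eq_bigr => k _.
by rewrite evalM evalE evalX xi expr1n mulr1.
Qed.

Lemma diff_X_exp (x w : 'rV[K]_n) k : w ord0 i0 = 0 -> diff_at ('X_i0 ^+ k) x w = 0.
Proof.
move=> wi; elim: k => [|k IH]; first by rewrite expr0 -mpolyC1 diffC.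
by rewrite exprS diffM IH diffX wi mul0r mulr0 addr0.
Qed.

Lemma diff_homogenize F x w : x ord0 i0 = 1 -> w ord0 i0 = 0 ->
  diff_at (homogenize F) x w = diff_at F x w.
Proof.
move=> xi wi; rewrite [in RHS](msize_partition F) !diff_sum; apply: eq_bigr => k _.
by rewrite diffM diff_X_exp // evalE evalX xi expr1n mulr1 mulr0 addr0.
Qed.

Lemma homogeneous_coord : homogeneous ('X_i0 : {mpoly K[n]}).
Proof. by exists 1%N; rewrite dhomogX /= mdeg1. Qed.

(** By irreducibility, since the points outside the chart lie on a hyperplane that
    does not contain the curve. *)
Lemma vanishes_homog F : homogeneous F -> vanishes F ->
  forall x, X x -> eval_at F x = 0.
Proof.
move=> [d hF] vF.
have [|//|h] := @curve_prime F 'X_i0 (ex_intro _ d hF) homogeneous_coord.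
  move=> x Xx; rewrite evalX; have [->|xi] := eqVneq (x ord0 i0) 0; first by right.
  left; have := vF _ (chart_scale Xx xi); rewrite (eval_homog_scale _ _ hF).
  by move/eqP; rewrite mulf_eq0 expf_eq0 invr_eq0 (negPf xi) andbF /= => /eqP.
by have [u /h] := Xi0; rewrite evalX => ->; rewrite eqxx.
Qed.

Lemma vanishes_homogenize F : vanishes F ->
  forall x, X x -> eval_at (homogenize F) x = 0.
Proof.
move=> vF; apply: vanishes_homog.
  by exists (msize F); exact: homogenize_homog.
by move=> y yc; rewrite eval_homogenize ?vF //; case: yc.
Qed.

(** The ideal of the chart inherits primality from the curve, by homogenizing. *)
Lemma vanishes_prime : prime_set vanishes.
Proof.
split.
- by move=> y _; rewrite eval0.
- have [y yc] := chart_nonempty; move/(_ _ yc)/eqP.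
  by rewrite eval1 oner_eq0.
- move=> a F G vu vv y yc.
  by rewrite evalD evalM vu // vv // mulr0 addr0.
- move=> F G FG.
  have hh H : homogeneous (homogenize H).
    by exists (msize H); exact: homogenize_homog.
  have huv : vanishes (homogenize F * homogenize G).
    by move=> y yc; have := FG _ yc; rewrite !evalM !eval_homogenize //; case: yc.
  have hhM : homogeneous (homogenize F * homogenize G).
    exists (msize F + msize G)%N; apply: dhomogM; exact: homogenize_homog.
  have [x /(vanishes_homog hhM huv)/eqP|h|h] := curve_prime (hh F) (hh G).
  + by rewrite evalM mulf_eq0 => /orP[/eqP|/eqP]; [left|right].
  + by left=> y yc; rewrite -eval_homogenize ?h //; case: yc.
  + by right=> y yc; rewrite -eval_homogenize ?h //; case: yc.
Qed.

(** The Zariski tangent line of the affine curve: unlike [tangent], it involves all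
    equations, homogeneous or not, and leaves out the direction of the point. *)
Definition chart_tangent (y w : 'rV[K]_n) : Prop :=
  forall F, vanishes F -> diff_at F y w = 0.

Lemma tangent_chart y w : chart y -> tangent X y w -> w ord0 i0 = 0 ->
  chart_tangent y w.
Proof.
move=> [_ yi] tw wi F vF; rewrite -diff_homogenize //; apply: tw.
  by exists (msize F); exact: homogenize_homog.
exact: vanishes_homogenize.
Qed.

Lemma chart_tangent_coord y w : chart_tangent y w -> w ord0 i0 = 0.
Proof.
move=> /(_ ('X_i0 - 1%:MP)) h; rewrite -(diffX i0 y).
have := h; rewrite diffB diffC subr0; apply.
by move=> z [_ zi]; rewrite evalB evalX zi evalC subrr.
Qed.

Lemma chart_tangent_tangent y w : chart_tangent y w -> tangent X y w.
Proof. by move=> h F _ FX; apply: h => z [Xz _]; exact: FX. Qed.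

Lemma tangent_point y : X y -> tangent X y y.
Proof. by move=> Xy F [d hF] FX; rewrite (euler _ hF) FX // mulr0. Qed.

Lemma tangent_lin x a w w' : tangent X x w -> tangent X x w' ->
  tangent X x (a *: w + w').
Proof. by move=> h h' F hF FX; rewrite diff_lin h // h' // mulr0 addr0. Qed.

(** This is where smoothness enters: the tangent spaces of the cone are planes. *)
Lemma tangent_span x u v w : X x -> tangent X x u -> tangent X x v ->
  tangent X x w -> u != 0 -> (forall c, v <> c *: u) ->
  exists a b, w = a *: u + b *: v.
Proof.
move=> Xx tu tv tw u0 uv; have [_ _ _ sm] := Xcurve.
have [T [hT dT]] := sm x Xx.
have mem z : tangent X x z -> z \in T by rewrite -hT.
have fr : free [:: u; v].
  rewrite free_cons free_cons nil_free span_seq1 span_nil !andbT.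
  have v0 : v != 0 by apply/eqP=> v0; apply: (uv 0); rewrite v0 scale0r.
  rewrite memv0 v0 andbT; apply/negP=> /vlineP[c uc].
  have c0 : c != 0 by apply: contra u0 => /eqP c0; rewrite uc c0 scale0r.
  by apply: (uv c^-1); rewrite uc scalerA mulVf // scale1r.
have ST : (<<[:: u; v]>> <= T)%VS.
  apply/span_subvP=> z; rewrite !inE => /orP[/eqP->|/eqP->]; exact: mem.
have eT : <<[:: u; v]>>%VS = T.
  by apply/eqP; rewrite eqEdim ST dT (eqP fr).
have := mem _ tw; rewrite -eT span_cons span_seq1.
by move/memv_addP=> [_ /vlineP[a ->] [_ /vlineP[b ->] ->]]; exists a, b.
Qed.

Lemma chart_tangent_exists y : chart y -> exists2 w, chart_tangent y w & w != 0.
Proof.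
move=> yc; have [Xy yi] := yc; have [_ _ _ sm] := Xcurve.
have [T [hT dT]] := sm y Xy.
have [w wT wy] : exists2 w, w \in T & w \notin <[y]>%VS.
  have : ~~ (T <= <[y]>)%VS.
    by apply/negP=> /dimvS; rewrite dT dim_vline; case: (y != 0).
  by move/subvPn.
have tw : tangent X y w by rewrite -hT.
exists (w - w ord0 i0 *: y).
  apply: tangent_chart => //; last by rewrite !mxE yi mulr1 subrr.
  by rewrite addrC -scaleNr; apply: tangent_lin => //; exact: tangent_point.
by apply: contra wy; rewrite subr_eq0 => /eqP->; rewrite memvZ // memv_line.
Qed.

Lemma chart_tangent_unique y w w' : chart y -> chart_tangent y w -> w != 0 ->
  chart_tangent y w' -> exists c, w' = c *: w.
Proof.
move=> yc cw w0 cw'; have [Xy yi] := yc.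
have [||||a [b e]] := @tangent_span y w y w' Xy _ _ _ w0.
- exact: chart_tangent_tangent.
- exact: tangent_point.
- exact: chart_tangent_tangent.
- move=> c /rowP/(_ i0)/eqP; rewrite mxE yi (chart_tangent_coord cw) mulr0.
  by rewrite oner_eq0.
exists a; rewrite e; have /rowP/(_ i0) := e.
rewrite !mxE (chart_tangent_coord cw) (chart_tangent_coord cw') yi.
by rewrite mulr0 add0r mulr1 => <-; rewrite scale0r addr0.
Qed.

End Chart.

(** * A tangent vector field *)

Section VectorField.
Variables (K : numClosedFieldType) (n : nat) (X : set 'rV[K]_n).
Implicit Types (F G : {mpoly K[n]}) (x y u v w : 'rV[K]_n).
Hypothesis Xcurve : smooth_projective_curve X.
Variable i0 : 'I_n.
Hypothesis Xi0 : exists2 u, X u & u ord0 i0 != 0.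
Variables (L : fieldType) (phi : {rmorphism {mpoly K[n]} -> L}).
Hypothesis phi0 : forall F, phi F = 0 <-> vanishes X i0 F.
Hypothesis phi_frac : forall l, exists F G, ~ vanishes X i0 G /\ l = phi F / phi G.

(** At each point of the chart the differentials of the equations have a nonzero
    common kernel, so the maximal minors of their matrix vanish on the curve; hence
    they also have a nonzero common kernel over the function field. Clearing
    denominators in it gives a derivation of the polynomial ring that preserves the
    ideal of the curve. *)
Lemma vector_field : exists W : 'I_n -> {mpoly K[n]},
  (forall F, vanishes X i0 F -> vanishes X i0 (\sum_i W i * F^`M(i))) /\
  exists i, ~ vanishes X i0 (W i).
Proof.
pose S : set 'rV[L]_n :=
  [set s | exists2 F, vanishes X i0 F & s = \row_i phi F^`M(i)].
have [m [A [Afree AS SA]]] := independent_rows S.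
have mn : (m < n)%N.
  have : (m <= n)%N by rewrite -[X in (X <= _)%N](eqP Afree) rank_leq_col.
  rewrite leq_eqVlt => /orP[/eqP mn|//]; exfalso.
  (* otherwise some Jacobian determinant is nonzero at a point of the chart *)
  have /choice[F hF] : forall i, exists F, vanishes X i0 F /\
      row i A = \row_k phi F^`M(k).
    by move=> i; have [F vF e] := AS i; exists F.
  move: A Afree AS SA F hF; rewrite mn => A Afree _ _ F hF.
  have : \det A != 0.
    by move: Afree; rewrite row_free_unit unitmxE unitfE.
  pose J : 'M[{mpoly K[n]}]_n := \matrix_(j, k) (F j)^`M(k).
  have -> : A = map_mx phi J.
    apply/matrixP=> j k; have [_ /rowP/(_ k)] := hF j.
    by rewrite !mxE.
  rewrite det_map_mx => /eqP dJ; apply: dJ; apply/phi0 => y yc.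
  rewrite /eval_at -[meval _ _]/((meval (y ord0) : {rmorphism _ -> _}) (\det J)).
  rewrite -det_map_mx -det_tr; apply/eqP/det0P.
  have [w tw w0] := chart_tangent_exists Xcurve Xi0 yc.
  exists w => //; apply/rowP=> j; rewrite !mxE -[RHS](tw (F j)); last by have [] := hF j.
  rewrite /diff_at.
  by apply: eq_bigr => k _; rewrite !mxE mulrC.
have [C [ck0 AC]] : exists C : 'M[L]_n, C != 0 /\ A *m C = 0.
  exists (cokermx A); split; last exact: mulmx_coker.
  by rewrite -mxrank_eq0 mxrank_coker (eqP Afree) subn_eq0 -ltnNge.
have [j [k ckjk]] : exists j k, C j k != 0.
  apply: contrapT => /forallNP h; move/eqP: ck0; apply; apply/matrixP=> j k.
  by rewrite mxE; apply/eqP; apply: contraT => jk; case: (h j); exists k.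
pose w i := C i k.
have kerw F : vanishes X i0 F -> \sum_i phi F^`M(i) * w i = 0.
  move=> vF; pose s := \row_i phi F^`M(i).
  have /submxP[D sD] : (s <= A)%MS by apply: SA; exists F.
  have : s *m C = 0 by rewrite sD -mulmxA AC mulmx0.
  move=> /rowP/(_ k); rewrite !mxE => e; rewrite -[RHS]e.
  by apply: eq_bigr => i _; rewrite mxE.
have /choice[P hP] : forall i, exists PQ : {mpoly K[n]} * {mpoly K[n]},
    ~ vanishes X i0 PQ.2 /\ w i = phi PQ.1 / phi PQ.2.
  by move=> i; have [F [G FG]] := phi_frac (w i); exists (F, G).
pose c := \prod_i phi (P i).2.
have pn0 i : phi (P i).2 != 0.
  by apply/eqP=> /phi0; have [] := hP i.
have c0 : c != 0 by apply/prodf_neq0 => i _.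
pose W i := (P i).1 * \prod_(l | l != i) (P l).2.
have phiW i : phi (W i) = c * w i.
  have [_ ->] := hP i; pose r := \prod_(l | l != i) phi (P l).2.
  have -> : phi (W i) = phi (P i).1 * r by rewrite rmorphM rmorph_prod.
  have -> : c = phi (P i).2 * r by rewrite /c (bigD1 i).
  by rewrite [RHS]mulrAC (mulrC (phi (P i).2)) divfK.
exists W; split.
  move=> F vF; apply/phi0; rewrite rmorph_sum.
  transitivity (c * \sum_i phi F^`M(i) * w i); last by rewrite kerw // mulr0.
  rewrite mulr_sumr; apply: eq_bigr => i _.
  by rewrite [LHS](rmorphM phi) phiW -mulrA (mulrC (w i)).
exists j => /phi0/eqP; rewrite phiW mulf_eq0 (negPf c0) /=.
by rewrite (negPf ckjk).
Qed.
End VectorField.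

(** * Orders of vanishing and the local ring at a point *)

Section Derivation.
Variables (K : fieldType) (n : nat) (W : 'I_n -> {mpoly K[n]}).
Implicit Types (F G : {mpoly K[n]}) (y : 'rV[K]_n).

Definition vfield F : {mpoly K[n]} := \sum_i W i * F^`M(i).

Definition vfield_at y : 'rV[K]_n := \row_i eval_at (W i) y.

Lemma vfieldD F G : vfield (F + G) = vfield F + vfield G.
Proof.
rewrite /vfield -big_split; apply: eq_bigr => i _ /=.
by rewrite mderivD mulrDr.
Qed.

Lemma vfieldC c : vfield c%:MP = 0.
Proof. by rewrite /vfield big1 // => i _; rewrite mderivC mulr0. Qed.

Lemma vfieldM F G : vfield (F * G) = vfield F * G + F * vfield G.
Proof.
rewrite /vfield mulr_suml mulr_sumr -big_split; apply: eq_bigr => i _ /=.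
by rewrite mderivM; ring.
Qed.

Lemma vfieldCM c F : vfield (c%:MP * F) = c%:MP * vfield F.
Proof. by rewrite vfieldM vfieldC mul0r add0r. Qed.

Lemma vfield0 : vfield 0 = 0.
Proof. by rewrite -mpolyC0 vfieldC. Qed.

Lemma vfieldB F G : vfield (F - G) = vfield F - vfield G.
Proof. by rewrite vfieldD -mulN1r -mpolyC1 -mpolyCN vfieldCM mpolyCN mulN1r. Qed.

Lemma vfield_sum I (r : seq I) (P : pred I) (F : I -> {mpoly K[n]}) :
  vfield (\sum_(i <- r | P i) F i) = \sum_(i <- r | P i) vfield (F i).
Proof. by apply: (big_morph vfield vfieldD vfield0). Qed.

Lemma vfieldX i : vfield 'X_i = W i.
Proof.
rewrite /vfield (bigD1 i) //= mderiv_X eqxx mulr1 big1 ?addr0 //.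
by move=> j /negPf ji; rewrite mderiv_X ji mulr0.
Qed.

Lemma eval_vfield F y : eval_at (vfield F) y = diff_at F y (vfield_at y).
Proof.
rewrite /vfield eval_sum; apply: eq_bigr => i _.
by rewrite evalM mxE mulrC.
Qed.

(** In characteristic 0 and where the field does not vanish, this says that the
    restriction of [F] to the curve vanishes to order at least [k] at [y]. *)
Definition flat y (k : nat) F : Prop :=
  forall j, (j < k)%N -> eval_at (iter j vfield F) y = 0.

Lemma flatS y k F : flat y k.+1 F <-> eval_at F y = 0 /\ flat y k (vfield F).
Proof.
split=> [h|[h0 h] [|j] jk //].
  split; first exact: (h 0%N).
  by move=> j jk; rewrite -iterSr; exact: (h j.+1).
by rewrite iterSr; exact: h.
Qed.

Lemma iter_vfieldD k F G :
  iter k vfield (F + G) = iter k vfield F + iter k vfield G.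
Proof. by elim: k => //= k ->; rewrite vfieldD. Qed.

Lemma flatD y k F G : flat y k F -> flat y k G -> flat y k (F + G).
Proof. by move=> hF hG j jk; rewrite iter_vfieldD evalD hF ?hG ?addr0. Qed.

Lemma flatW y k l F : (l <= k)%N -> flat y k F -> flat y l F.
Proof. by move=> lk hF j jl; apply: hF; exact: leq_trans lk. Qed.

Lemma flatMl y k F G : flat y k F -> flat y k (G * F).
Proof.
elim: k F G => [|k IH] F G hF //.
move/flatS: (hF) => [F0 dF]; apply/flatS; split; first by rewrite evalM F0 mulr0.
rewrite vfieldM; apply: flatD; last exact: IH.
apply: IH; exact: flatW hF.
Qed.

Lemma iter_vfield_M y k F G : flat y k F ->
  eval_at (iter k vfield (G * F)) y = eval_at G y * eval_at (iter k vfield F) y.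
Proof.
elim: k F G => [|k IH] F G hF; first by rewrite /= evalM.
move/flatS: (hF) => [F0 dF].
rewrite !iterSr vfieldM iter_vfieldD evalD (IH _ _ dF).
rewrite (flatMl (vfield G) hF) ?add0r //.
Qed.

(** The Taylor coefficient of a power of a local parameter; in characteristic 0 the
    factorial does not vanish, so that the order can be read off. *)
Lemma iter_vfield_X (T P : {mpoly K[n]}) y k : eval_at T y = 0 ->
  flat y k (T ^+ k * P) /\
  eval_at (iter k vfield (T ^+ k * P)) y =
    k`!%:R * eval_at (vfield T) y ^+ k * eval_at P y.
Proof.
move=> T0; elim: k P => [|k IH] P.
  by split=> //=; rewrite !expr0 mulr1 !mul1r.
have e : vfield (T ^+ k.+1 * P) =
    T ^+ k * (k.+1%:R * vfield T * P + T * vfield P).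
  have eX j : vfield (T ^+ j.+1) = j.+1%:R * T ^+ j * vfield T.
    elim: j => [|j IHj]; first by rewrite expr1 expr0 mulr1 mul1r.
    rewrite exprS vfieldM IHj [T ^+ j.+1]exprS [in RHS]mulrSr; ring.
  rewrite vfieldM eX exprS; ring.
have [IH1 IH2] := IH (k.+1%:R * vfield T * P + T * vfield P).
split; first by apply/flatS; rewrite e; split=> //; rewrite exprS !evalM T0 !mul0r.
rewrite iterSr e IH2 evalD !evalM T0 mul0r addr0 eval_nat factS natrM exprS.
ring.
Qed.

End Derivation.

Section LocalRing.
Variables (K : numClosedFieldType) (n : nat) (X : set 'rV[K]_n).
Implicit Types (F G : {mpoly K[n]}) (x y u v w : 'rV[K]_n).
Hypothesis Xcurve : smooth_projective_curve X.
Variable i0 : 'I_n.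
Variables (L : fieldType) (phi : {rmorphism {mpoly K[n]} -> L}).
Hypothesis phi0 : forall F, phi F = 0 <-> vanishes X i0 F.
Variable W : 'I_n -> {mpoly K[n]}.
Hypothesis Wvan : forall F, vanishes X i0 F -> vanishes X i0 (vfield W F).
Variable y : 'rV[K]_n.
Hypothesis yc : chart X i0 y.
Hypothesis Wy : vfield_at W y != 0.

(** The graph of the evaluation at [y] on the local ring of the curve at [y]. *)
Definition regular_at (o : L) (c : K) : Prop :=
  exists P Q, [/\ eval_at Q y != 0, o = phi P / phi Q & c = eval_at P y / eval_at Q y].

Lemma phi_neq0 F : eval_at F y != 0 -> phi F != 0.
Proof. by move=> F0; apply: contra F0 => /eqP/phi0/(_ _ yc) ->. Qed.

Lemma phi_eq F G : vanishes X i0 (F - G) -> phi F = phi G.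
Proof. by move/phi0/eqP; rewrite rmorphB subr_eq0 => /eqP. Qed.

Lemma phi_eval F G : phi F = phi G -> eval_at F y = eval_at G y.
Proof.
move=> e; apply/eqP; rewrite -subr_eq0 -evalB; apply/eqP.
by move: y yc; apply/phi0; rewrite rmorphB e subrr.
Qed.

Lemma regular_poly F : regular_at (phi F) (eval_at F y).
Proof.
by exists F, 1; split; rewrite ?eval1 ?oner_eq0 ?rmorph1 ?divr1.
Qed.

Lemma regularD o c o' c' : regular_at o c -> regular_at o' c' ->
  regular_at (o + o') (c + c').
Proof.
move=> [P [Q [Q0 -> ->]]] [P' [Q' [Q0' -> ->]]].
exists (P * Q' + P' * Q), (Q * Q'); split.
- by rewrite evalM mulf_neq0.
- by rewrite addf_div ?phi_neq0 // rmorphD !rmorphM.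
- by rewrite addf_div // evalD !evalM.
Qed.

Lemma regularM o c o' c' : regular_at o c -> regular_at o' c' ->
  regular_at (o * o') (c * c').
Proof.
move=> [P [Q [Q0 -> ->]]] [P' [Q' [Q0' -> ->]]].
exists (P * P'), (Q * Q'); split.
- by rewrite evalM mulf_neq0.
- by rewrite mulf_div !rmorphM.
- by rewrite mulf_div !evalM.
Qed.

Lemma regularX o c k : regular_at o c -> regular_at (o ^+ k) (c ^+ k).
Proof.
move=> oc; elim: k => [|k IH]; last by rewrite !exprS; exact: regularM.
by rewrite !expr0 -(rmorph1 phi) -(eval1 y); exact: regular_poly.
Qed.

Lemma regularV o c : c != 0 -> regular_at o c -> regular_at o^-1 c^-1.
Proof.
move=> c0 [P [Q [Q0 -> cE]]]; exists Q, P; split.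
- by move: c0; rewrite cE mulf_eq0 negb_or => /andP[].
- by rewrite invf_div.
- by rewrite cE invf_div.
Qed.

Lemma regular_neq0 o c : regular_at o c -> c != 0 -> o != 0.
Proof.
move=> [P [Q [Q0 -> ->]]]; rewrite mulf_eq0 negb_or => /andP[P0 _].
by rewrite mulf_neq0 ?invr_eq0 ?phi_neq0.
Qed.

Lemma vfield_tangent : chart_tangent X i0 y (vfield_at W y).
Proof. by move=> F vF; rewrite -eval_vfield (Wvan vF). Qed.

(** By smoothness, a linear form that kills the tangent line of the chart is the
    differential of an equation. *)
Lemma equation_with_differential (s : 'rV[K]_n) :
  \sum_l s ord0 l * vfield_at W y ord0 l = 0 ->
  exists2 F, vanishes X i0 F & forall l, eval_at F^`M(l) y = s ord0 l.
Proof.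
move=> sw.
pose S : set 'rV[K]_n :=
  [set s | exists2 F, vanishes X i0 F & s = \row_l eval_at F^`M(l) y].
have [m [A [_ AS SA]]] := independent_rows S.
have [C [AC sub]] : exists C : 'M[K]_n, A *m C = 0 /\
    forall s : 'rV_n, s *m C = 0 -> (s <= A)%MS.
  exists (cokermx A); split; first exact: mulmx_coker.
  by move=> s' /eqP; rewrite -submxE.
have /sub/submxP[D sD] : s *m C = 0.
  apply/rowP=> k; rewrite !mxE.
  have [|a ea] := chart_tangent_unique Xcurve yc vfield_tangent Wy (w' := (col k C)^T).
    move=> F vF; have /submxP[E sE] : (\row_l eval_at F^`M(l) y <= A)%MS.
      by apply: SA; exists F.
    have := congr1 (fun M => (M *m C) ord0 k) sE.
    rewrite -mulmxA AC mulmx0 !mxE => <-; apply: eq_bigr => l _.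
    by rewrite !mxE.
  transitivity (a * \sum_l s ord0 l * vfield_at W y ord0 l); last by rewrite sw mulr0.
  rewrite mulr_sumr; apply: eq_bigr => l _.
  by have /rowP/(_ l) := ea; rewrite !mxE => ->; rewrite mulrCA.
have /choice[F hF] : forall i, exists F, vanishes X i0 F /\
    row i A = \row_l eval_at F^`M(l) y.
  by move=> i; have [F vF e] := AS i; exists F.
exists (\sum_i (D ord0 i)%:MP * F i).
  move=> z zc; rewrite eval_sum big1 // => i _.
  by rewrite evalM (proj1 (hF i) _ zc) mulr0.
move=> l; rewrite raddf_sum eval_sum sD mxE; apply: eq_bigr => i _ /=.
rewrite mderivM mderivC mul0r add0r evalM evalC; congr (_ * _).
by have [_ /rowP/(_ l)] := hF i; rewrite !mxE => ->.
Qed.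

(** The maximal ideal of the local ring is principal: the Jacobian criterion and
    Cramer's rule write each coordinate difference as a multiple of one of them. *)
Lemma local_parameter : exists T : {mpoly K[n]},
  [/\ eval_at T y = 0, eval_at (vfield W T) y != 0 &
    forall o, regular_at o 0 -> exists o' c', o = phi T * o' /\ regular_at o' c'].
Proof.
have [w wE] : exists w, w = vfield_at W y by exists (vfield_at W y).
pose m (k : 'I_n) := 'X_k - (y ord0 k)%:MP : {mpoly K[n]}.
have [i wi] : exists i, w ord0 i != 0.
  apply: contrapT => /forallNP h; move/eqP: Wy; apply; rewrite -wE; apply/rowP=> j.
  by rewrite [RHS]mxE; apply/eqP; apply: contraT => jk; case: (h j).
(* the parameter is a coordinate along which the field moves the point *)
pose t (l : 'I_n) : K := (l == i)%:R / w ord0 i.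
pose T := (w ord0 i)^-1%:MP * m i.
have Tm : T = \sum_l (t l)%:MP * m l.
  rewrite (bigD1 i) //= /t eqxx mul1r big1 ?addr0 // => l /negPf ->.
  by rewrite mul0r mpolyC0 mul0r.
have tw : \sum_l t l * w ord0 l = 1.
  rewrite (bigD1 i) //= /t eqxx mul1r mulVf // big1 ?addr0 // => l /negPf ->.
  by rewrite !mul0r.
have T0 : eval_at T y = 0.
  by rewrite evalM evalB evalX !evalC subrr mulr0.
have DT : eval_at (vfield W T) y = 1.
  rewrite vfieldCM vfieldB vfieldX vfieldC subr0 evalM evalC.
  have -> : eval_at (W i) y = w ord0 i by rewrite wE mxE.
  by rewrite mulVf.
have /choice[F hF] : forall k, exists F, vanishes X i0 F /\
    forall l, eval_at F^`M(l) y = (l == k)%:R - w ord0 k * t l.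
  move=> k; have [|F vF eF] := @equation_with_differential
      (\row_l ((l == k)%:R - w ord0 k * t l)).
    rewrite -wE; under eq_bigr do rewrite mxE mulrBl -mulrA.
    rewrite sumrB -mulr_sumr tw mulr1 (bigD1 k) //= eqxx mul1r big1 ?addr0 ?subrr //.
    by move=> l /negPf->; rewrite mul0r.
  by exists F; split=> // l; rewrite eF mxE.
have /choice[M hM] : forall k, exists M : 'I_n -> {mpoly K[n]},
    F k = \sum_l M l * m l /\
    forall l, eval_at (M l) y = (l == k)%:R - w ord0 k * t l.
  move=> k; have [c [e1 e2]] := hadamard (F k) y; exists c; split.
    by rewrite {1}e1 (proj1 (hF k) _ yc) mpolyC0 add0r.
  by move=> l; rewrite e2; exact: (proj2 (hF k)).
(* modulo the curve, [N] maps the coordinate differences to [w] times the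
   parameter, and its value at [y] is the identity *)
pose N : 'M[{mpoly K[n]}]_n := \matrix_(k, l) (M k l + (w ord0 k * t l)%:MP).
pose mc : 'cV[{mpoly K[n]}]_n := \col_l m l.
have Nm k : (N *m mc) k ord0 = F k + (w ord0 k)%:MP * T.
  rewrite mxE (proj1 (hM k)) Tm mulr_sumr -big_split; apply: eq_bigr => l _.
  by rewrite !mxE mulrDl mpolyCM mulrA.
pose Q0 := \det N.
have Q0y : eval_at Q0 y = 1.
  rewrite /Q0 /eval_at -[meval _ _]/((meval (y ord0) : {rmorphism _ -> _}) (\det N)).
  rewrite -det_map_mx -[RHS](det1 _ n); congr (\det _).
  apply/matrixP=> k l; rewrite !mxE /= -/(eval_at _ _) evalD evalC (proj2 (hM k)).
  by rewrite subrK eq_sym.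
have [Ad AdN] : exists Ad, Ad *m N = Q0%:M by exists (\adj N); exact: mul_adj_mx.
pose h k := \sum_j Ad k j * (w ord0 j)%:MP.
have mk k : Q0 * m k = \sum_j Ad k j * F j + T * h k.
  have e : (Ad *m (N *m mc)) k ord0 = Q0 * m k.
    by rewrite mulmxA AdN mul_scalar_mx !mxE.
  rewrite -e [LHS]mxE mulr_sumr -big_split; apply: eq_bigr => j _ /=; rewrite Nm.
  ring.
exists T; split=> //; first by rewrite DT oner_eq0.
move=> o [P [Q [Qy -> c0]]].
have Py : eval_at P y = 0.
  by move/esym/eqP: c0; rewrite mulf_eq0 invr_eq0 (negPf Qy) orbF => /eqP.
have [c [eP _]] := hadamard P y; rewrite Py mpolyC0 add0r in eP.
pose H := \sum_k c k * h k.
have e : phi Q0 * phi P = phi T * phi H.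
  rewrite -!rmorphM; apply: phi_eq.
  have -> : Q0 * P - T * H = \sum_k c k * \sum_j Ad k j * F j.
    rewrite eP /H !mulr_sumr -sumrB; apply: eq_bigr => k _.
    by rewrite mulrCA mk; ring.
  move=> z zc; rewrite eval_sum big1 // => k _; rewrite evalM eval_sum big1 ?mulr0 //.
  by move=> j _; rewrite evalM (proj1 (hF j) _ zc) mulr0.
exists (phi H / (phi Q0 * phi Q)), (eval_at H y / (eval_at Q0 y * eval_at Q y)).
have Q0n : phi Q0 != 0 by rewrite phi_neq0 // Q0y oner_eq0.
split; last first.
  exists H, (Q0 * Q); split; rewrite ?evalM ?rmorphM //.
  by rewrite Q0y mul1r.
have Qn : phi Q != 0 by rewrite phi_neq0.
by rewrite mulrA -e; field; rewrite Q0n Qn.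
Qed.

End LocalRing.

Definition scalars (K L : fieldType) n (phi : {rmorphism {mpoly K[n]} -> L}) :
  {rmorphism K -> L} := phi \o @mpolyC n K.

Section Valuation.
Variables (K : numClosedFieldType) (n : nat) (X : set 'rV[K]_n).
Implicit Types (F G : {mpoly K[n]}) (x y u v w : 'rV[K]_n).
Variable i0 : 'I_n.
Variables (L : fieldType) (phi : {rmorphism {mpoly K[n]} -> L}).
Hypothesis phi0 : forall F, phi F = 0 <-> vanishes X i0 F.
Variable W : 'I_n -> {mpoly K[n]}.
Hypothesis Wvan : forall F, vanishes X i0 F -> vanishes X i0 (vfield W F).
Variable y : 'rV[K]_n.
Hypothesis yc : chart X i0 y.
Local Notation reg := (regular_at phi y).
Variable T : {mpoly K[n]}.
Hypothesis T0 : eval_at T y = 0.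
Hypothesis DT : eval_at (vfield W T) y != 0.
Hypothesis Tdiv : forall o, reg o 0 -> exists o' c', o = phi T * o' /\ reg o' c'.

Lemma regular_fun o c c' : reg o c -> reg o c' -> c = c'.
Proof.
move=> [P [Q [Q0 -> ->]]] [P' [Q' [Q0' e ->]]]; apply/eqP.
rewrite eqr_div // -!evalM; apply/eqP/(phi_eval phi0 yc).
rewrite !rmorphM; apply/eqP.
by rewrite -eqr_div ?(phi_neq0 phi0 yc) //; apply/eqP.
Qed.

Lemma iter_vfield_vanishes k F : vanishes X i0 F -> vanishes X i0 (iter k (vfield W) F).
Proof. by move=> vF; elim: k => //= k; exact: Wvan. Qed.

Lemma iter_vfieldB k F G :
  iter k (vfield W) (F - G) = iter k (vfield W) F - iter k (vfield W) G.
Proof. by elim: k => //= k ->; rewrite vfieldB. Qed.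

(** Each division by the parameter is possible because the next derivative, which
    vanishes, is up to a nonzero factor the residue of the quotient. *)
Lemma flat_factor k F : flat W y k F -> exists o c,
  [/\ phi F = phi T ^+ k * o, reg o c &
      eval_at (iter k (vfield W) F) y = k`!%:R * eval_at (vfield W T) y ^+ k * c].
Proof.
elim: k => [|k IH] hF.
  exists (phi F), (eval_at F y); rewrite !expr0 mulr1 !mul1r; split=> //.
  exact: regular_poly.
have [o [c [eF oc ec]]] := IH (flatW (leqnSn k) hF).
have c0 : c = 0.
  have := hF k (ltnSn k); rewrite ec => /eqP; rewrite mulf_eq0 mulf_eq0.
  by rewrite pnatr_eq0 eqn0Ngt fact_gt0 /= expf_eq0 (negPf DT) andbF => /eqP.
rewrite c0 in oc; have [o' [c' [eo rc']]] := Tdiv oc.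
exists o', c'; split=> //; first by rewrite eF eo exprSr mulrA.
have [P [Q [Qy eo' ->]]] := rc'.
have QF : vanishes X i0 (Q * F - T ^+ k.+1 * P).
  apply/phi0; rewrite rmorphB !rmorphM rmorphXn eF eo eo' exprSr.
  by rewrite -!mulrA [_ * (phi P / _)]mulrA [_ / phi Q]mulrC mulrCA; field; rewrite (phi_neq0 phi0 yc).
have := iter_vfield_vanishes k.+1 QF yc.
have [_ h2] := iter_vfield_X W P k.+1 T0.
rewrite iter_vfieldB evalB (iter_vfield_M _ hF) h2 => /eqP; rewrite subr_eq0 => /eqP e.
by rewrite mulrA -e mulrC mulKf.
Qed.

(** Krull's intersection theorem: the numerators of the successive quotients satisfy
    a linear relation by Hilbert's basis theorem, and after division it says that a
    function with a nonzero value at [y] is zero. *)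
Lemma flat_all F : (forall k, flat W y k F) -> phi F = 0.
Proof.
move=> hF; apply/eqP; apply: contraT => F0.
have /choice[PQ hPQ] : forall k, exists PQ : {mpoly K[n]} * {mpoly K[n]},
    eval_at PQ.2 y != 0 /\ phi F = phi T ^+ k * (phi PQ.1 / phi PQ.2).
  move=> k; have [o [c [-> [P [Q [Q0 -> _]]] _]]] := flat_factor (hF k).
  by exists (P, Q).
pose P k := (PQ k).1; pose Q k := (PQ k).2.
have Q0 k : phi (Q k) != 0 by rewrite (phi_neq0 phi0 yc) //; case: (hPQ k).
have tau0 : phi T != 0.
  by apply: contra F0 => /eqP t0; have [_ ->] := hPQ 1%N; rewrite t0 expr1 mul0r.
have eP k : phi (P k) = phi F / phi T ^+ k * phi (Q k).
  by have [_ ->] := hPQ k; rewrite -/(P k) -/(Q k); field; rewrite Q0 expf_neq0.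
have [k [C eC]] := @noeth_mpoly K n P.
have : phi (Q k - \sum_(i < k) C i * Q i * T ^+ (k - i)) = 0.
  rewrite rmorphB rmorph_sum; apply/eqP; rewrite subr_eq0.
  have cn0 : phi F / phi T ^+ k != 0 by rewrite mulf_neq0 ?invr_eq0 ?expf_neq0.
  (* the relation, with all quotients expressed by the last one *)
  apply/eqP/(mulfI cn0); rewrite -eP eC rmorph_sum mulr_sumr; apply: eq_bigr => i _.
  rewrite !rmorphM rmorphXn eP.
  have -> : phi T ^+ k = phi T ^+ (k - i) * phi T ^+ i.
    by rewrite -exprD subnK // ltnW.
  by field; rewrite !expf_neq0.
move/phi0/(_ _ yc); rewrite evalB eval_sum big1.
  by rewrite subr0 => Qy; case: (hPQ k); rewrite -/(Q k) Qy eqxx.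
move=> i _; rewrite evalM evalE T0 expr0n subn_eq0 leqNgt ltn_ord /=.
exact: mulr0.
Qed.

Section PoleExpansion.
Variables (h e : L) (ce : K).
Hypothesis he : e = phi T * h.
Hypothesis ree : reg e ce.
Hypothesis ce0 : ce != 0.
Local Notation io := (scalars phi).

(** If [h] has a simple pole at [y], multiples of its powers remove the polar part
    of any other function term by term. *)
Lemma pole_expansion k o f c : reg o c -> o = phi T ^+ k * f ->
  exists p o' c', f = (map_poly io p).[h] + o' /\ reg o' c'.
Proof.
elim: k o f c => [|k IH] o f c oc.
  rewrite expr0 mul1r => <-; exists 0, o, c.
  by rewrite map_poly0 horner0 add0r.
move=> eo; pose a := c / ce ^+ k.+1.
have [|o' [c' [eo' rc']]] := Tdiv (o := o - phi a%:MP * e ^+ k.+1).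
  have : reg (o + phi (- a)%:MP * e ^+ k.+1) (c + (- a) * ce ^+ k.+1).
    apply: regularD => //; apply: regularM => //; last exact: regularX.
    by have := regular_poly phi y (- a)%:MP; rewrite evalC.
  by rewrite mpolyCN rmorphN mulNr mulNr /a divfK ?expf_neq0 // subrr.
have tau0 : phi T != 0.
  have := regular_neq0 phi0 yc ree ce0; rewrite he mulf_eq0 negb_or.
  by case/andP.
have [|p [o2 [c2 [ef rc2]]]] := IH o' (f - phi a%:MP * h ^+ k.+1) c' rc'.
  by apply: (mulfI tau0); rewrite -eo' eo he exprMn !exprS; ring.
exists (p + a *: 'X^(k.+1)), o2, c2; split=> //.
rewrite rmorphD hornerD /= map_polyZ map_polyXn hornerZ hornerXn /=.
by rewrite addrAC -ef subrK.
Qed.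

End PoleExpansion.
End Valuation.

(** * Contact with the polar hyperplanes *)

Section LinearForms.
Variables (K : fieldType) (n : nat).
Implicit Types (a u x z : 'rV[K]_n).

Definition lform a : {mpoly K[n]} := \sum_k (a ord0 k)%:MP * 'X_k.

Definition dot a x : K := \sum_k a ord0 k * x ord0 k.

Lemma eval_lform a x : eval_at (lform a) x = dot a x.
Proof.
by rewrite eval_sum; apply: eq_bigr => k _; rewrite evalM evalC evalX.
Qed.

Lemma lform_homog a : lform a \is 1.-homog.
Proof.
apply: rpred_sum => k _; rewrite mul_mpolyC; apply: rpredZ.
by rewrite dhomogX /= mdeg1.
Qed.

Lemma dotZr a c x : dot a (c *: x) = c * dot a x.
Proof.
by rewrite mulr_sumr; apply: eq_bigr => k _; rewrite mxE mulrCA.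
Qed.

Lemma dot_delta k x : dot (delta_mx ord0 k) x = x ord0 k.
Proof.
rewrite /dot (bigD1 k) //= !mxE !eqxx mul1r big1 ?addr0 // => l /negPf lk.
by rewrite mxE lk andbF mul0r.
Qed.

Definition bil (M : 'M[K]_n) x z : K := dot (x *m M) z.

End LinearForms.

Section Contact.
Variables (K : numClosedFieldType) (n : nat) (X : set 'rV[K]_n).
Implicit Types (F G : {mpoly K[n]}) (x y z u v w : 'rV[K]_n).
Hypothesis Xcurve : smooth_projective_curve X.
Variable M : 'M[K]_n.
Hypothesis Mdiag : forall x z, X x -> X z ->
  bil M x z = 0 <-> exists c, z = c *: x.
Variable i0 : 'I_n.
Hypothesis Xi0 : exists2 u, X u & u ord0 i0 != 0.
Hypothesis Xtwo : exists u v, [/\ X u, X v & forall c, v <> c *: u].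
Local Notation van := (vanishes X i0).
Local Notation chartX := (chart X i0).

(** If the chart were a point, the equations that make every other coordinate
    proportional would hold on the whole curve. *)
Lemma chart_other y : chartX y -> exists2 z, chartX z & z != y.
Proof.
move=> [Xy yi]; apply: contrapT => h.
have zy z : chartX z -> z = y.
  by move=> zc; apply/eqP; apply: contraT => zy; case: h; exists z.
have all x : X x -> x = x ord0 i0 *: y.
  move=> Xx; apply/rowP=> k; rewrite mxE; apply/eqP; rewrite -subr_eq0; apply/eqP.
  pose F := lform (delta_mx ord0 k) - (y ord0 k) *: lform (delta_mx ord0 i0).
  have eF z : eval_at F z = z ord0 k - y ord0 k * z ord0 i0.
    rewrite evalB /eval_at mevalZ -!/(eval_at _ z) !eval_lform.
    by rewrite !dot_delta.
  rewrite mulrC -eF; apply: (@vanishes_homog _ _ _ Xcurve _ Xi0) => //.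
    exists 1%N; apply: rpredB; last apply: rpredZ; exact: lform_homog.
  by move=> z zc; rewrite eF (zy _ zc) yi mulr1 subrr.
have [u [v [Xu Xv uv]]] := Xtwo.
apply: (uv (v ord0 i0 / u ord0 i0)); rewrite (all v Xv) (all u Xu) !mxE yi !mulr1.
rewrite scalerA divfK //; apply/eqP => u0.
have := curve_neq0 Xcurve Xu; rewrite (all u Xu) u0 scale0r eqxx //.
Qed.

Lemma chart_avoid F y : ~ van F -> exists z, [/\ chartX z, z != y & eval_at F z != 0].
Proof.
move=> nF; have [z0 [zc0 zy]] : exists z, chartX z /\ z != y.
  have [z zc] := chart_nonempty Xcurve Xi0.
  have [zy|zy] := eqVneq z y; last by exists z.
  by have [z' zc' zz] := chart_other zc; exists z'; rewrite -zy.
have [k zk] : exists k, z0 ord0 k != y ord0 k.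
  apply: contrapT => /forallNP h; move/eqP: zy; apply; apply/rowP=> k.
  by apply/eqP; apply: contraT => hk; case: (h k).
have [_ _ _ pr] := vanishes_prime Xcurve Xi0.
apply: contrapT => h; have [] := pr F ('X_k - (y ord0 k)%:MP) _ => //.
  move=> z zc; rewrite evalM evalB evalX evalC.
  have [->|zy'] := eqVneq z y; first by rewrite subrr mulr0.
  have [->|Fz] := eqVneq (eval_at F z) 0; first by rewrite mul0r.
  by case: h; exists z.
by move=> /(_ _ zc0)/eqP; rewrite evalB evalX evalC subr_eq0 (negPf zk).
Qed.

Variables (L : fieldType) (phi : {rmorphism {mpoly K[n]} -> L}).
Hypothesis phi0 : forall F, phi F = 0 <-> van F.
Variable W : 'I_n -> {mpoly K[n]}.
Hypothesis Wvan : forall F, van F -> van (vfield W F).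
Hypothesis Wn0 : exists i, ~ van (W i).

(** The [j]-th derivative of the point along the flow. *)
Definition jet j (k : 'I_n) : {mpoly K[n]} := iter j (vfield W) 'X_k.

Definition jet_at j y : 'rV[K]_n := \row_k eval_at (jet j k) y.

Definition jet_pairing i j : {mpoly K[n]} :=
  \sum_k (\sum_l jet i l * (M l k)%:MP) * jet j k.

Lemma eval_jet_pairing i j y :
  eval_at (jet_pairing i j) y = bil M (jet_at i y) (jet_at j y).
Proof.
rewrite eval_sum; apply: eq_bigr => k _; rewrite evalM eval_sum !mxE.
by congr (_ * _); apply: eq_bigr => l _; rewrite evalM evalC mxE.
Qed.

Lemma vfield_jet_pairing i j : vfield W (jet_pairing i j) =
  jet_pairing i.+1 j + jet_pairing i j.+1.
Proof.
rewrite vfield_sum -big_split; apply: eq_bigr => k _ /=.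
rewrite vfieldM vfield_sum; congr (_ * _ + _).
by apply: eq_bigr => l _; rewrite vfieldM vfieldC mulr0 addr0.
Qed.

Lemma jet_at0 y : jet_at 0 y = y.
Proof. by apply/rowP=> k; rewrite mxE evalX. Qed.

Lemma jet_at1 y : jet_at 1 y = vfield_at W y.
Proof. by apply/rowP=> k; rewrite !mxE /jet /= vfieldX. Qed.

Lemma iter_vfield_lform a j y :
  eval_at (iter j (vfield W) (lform a)) y = dot a (jet_at j y).
Proof.
have -> : iter j (vfield W) (lform a) = \sum_k (a ord0 k)%:MP * jet j k.
  elim: j => [|j IH] //=; rewrite IH vfield_sum; apply: eq_bigr => k _.
  exact: vfieldCM.
by rewrite eval_sum; apply: eq_bigr => k _; rewrite evalM evalC mxE.
Qed.

Lemma iter_pairing i j y :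
  eval_at (iter j (vfield W) (lform (jet_at i y *m M))) y =
  eval_at (jet_pairing i j) y.
Proof. by rewrite iter_vfield_lform eval_jet_pairing. Qed.

(** The generic contact order of the curve with its polar hyperplanes is finite:
    otherwise the polar hyperplane of a point, having infinite contact with the curve
    there, would contain the curve. *)
Lemma contact_order : exists d, ~ van (jet_pairing 0 d) /\
  forall j, (j < d)%N -> van (jet_pairing 0 j).
Proof.
suff [d0 hd0] : exists d, ~ van (jet_pairing 0 d).
  pose P d := `[< ~ van (jet_pairing 0 d) >].
  have exP : exists d, P d by exists d0; apply/asboolP.
  case: (ex_minnP exP) => d /asboolP vd dmin; exists d; split=> // j jd.
  apply: contrapT => vj; have := dmin j; rewrite leqNgt jd.
  by move=> /(_ (asboolT vj)).
apply: contrapT => /forallNP h.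
have [i Wi] := Wn0.
have [y [yc _ Wiy]] := chart_avoid 0 Wi.
have Wy : vfield_at W y != 0.
  by apply: contra Wiy => /eqP/rowP/(_ i); rewrite !mxE => /eqP.
have [T [T0 DT Tdiv]] := local_parameter Xcurve phi0 Wvan yc Wy.
have /phi0 ly : phi (lform (y *m M)) = 0.
  apply: (flat_all phi0 Wvan yc T0 DT Tdiv) => k j _.
  by rewrite -{1}(jet_at0 y) iter_pairing; apply: contrapT => ne; apply: (h j) => /(_ _ yc).
have [z zc zy] := chart_other yc.
have [Xy yi] := yc; have [Xz zi] := zc.
have := ly _ zc; rewrite eval_lform => /(Mdiag Xy Xz)[c e].
move: zy; rewrite e; move/rowP/(_ i0): e; rewrite mxE zi yi mulr1 => <-.
by rewrite scale1r eqxx.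
Qed.

Section BasePoint.
Variables (d : nat) (y : 'rV[K]_n).
Hypothesis yc : chartX y.
Hypothesis dy : eval_at (jet_pairing 0 d) y != 0.
Hypothesis dmin : forall j, (j < d)%N -> van (jet_pairing 0 j).

Lemma contact_gt0 : (0 < d)%N.
Proof.
rewrite lt0n; apply: contra dy => /eqP ->; have [Xy _] := yc.
rewrite eval_jet_pairing !jet_at0; apply/eqP/(Mdiag Xy Xy).
by exists 1; rewrite scale1r.
Qed.

(** Differentiating the vanishing pairings of the point with its jets moves one
    derivative to the first argument, at the cost of a sign: the polar of the tangent
    vector has contact one less than the polar of the point. *)
Lemma pairing1_flat j : (j < d.-1)%N -> van (jet_pairing 1 j).
Proof.
move=> jd; have jd1 : (j.+1 < d)%N by rewrite -(prednK contact_gt0).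
move=> z zc; have := Wvan (dmin (ltnW jd1)) zc.
by rewrite vfield_jet_pairing evalD (dmin jd1 zc) addr0.
Qed.

Lemma pairing1_top : eval_at (jet_pairing 1 d.-1) y != 0.
Proof.
have dd : (d.-1 < d)%N by rewrite (prednK contact_gt0).
have := Wvan (dmin dd) yc.
rewrite vfield_jet_pairing evalD (prednK contact_gt0) => /eqP.
by rewrite addr_eq0 => /eqP ->; rewrite oppr_eq0.
Qed.

Lemma base_vfield_neq0 : vfield_at W y != 0.
Proof.
apply: contra pairing1_top => /eqP W0.
rewrite eval_jet_pairing jet_at1 W0 /bil mul0mx /dot big1 // => k _.
by rewrite mxE mul0r.
Qed.

Let ell := lform (y *m M).
Let ell' := lform (vfield_at W y *m M).
Let h := phi ell' / phi ell.
Local Notation io := (scalars phi).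
Local Notation reg := (regular_at phi y).

(** The numerator and the denominator of [h] vanish at [y] to orders [d.-1] and [d],
    so the pole of [h] is simple and [pole_expansion] applies. *)
Lemma coordinate_expansion : exists T,
  [/\ eval_at T y = 0, exists2 c, c != 0 & reg (phi T * h) c, phi T != 0 &
   forall k, exists p o c, phi 'X_k / phi ell = (map_poly io p).[h] + o /\ reg o c].
Proof.
have [T [T0 DT Tdiv]] := local_parameter Xcurve phi0 Wvan yc base_vfield_neq0.
have kfact k : k`!%:R != 0 :> K by rewrite pnatr_eq0 -lt0n fact_gt0.
have [e0 [c0 [E0 r0 C0]]] : exists o c, [/\ phi ell = phi T ^+ d * o, reg o c & c != 0].
  have [|o [c [E r C]]] := flat_factor phi0 Wvan yc T0 DT Tdiv (k := d) (F := ell).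
    by move=> j jd; rewrite /ell -{1}(jet_at0 y) iter_pairing dmin.
  exists o, c; split=> //; apply: contra dy => /eqP cz.
  by rewrite -iter_pairing jet_at0 C cz mulr0.
have [e1 [c1 [E1 r1 C1]]] : exists o c,
    [/\ phi ell' = phi T ^+ d.-1 * o, reg o c & c != 0].
  have [|o [c [E r C]]] := flat_factor phi0 Wvan yc T0 DT Tdiv (k := d.-1) (F := ell').
    by move=> j jd; rewrite /ell' -{1}(jet_at1 y) iter_pairing pairing1_flat.
  exists o, c; split=> //; apply: contra pairing1_top => /eqP cz.
  by rewrite -iter_pairing jet_at1 C cz mulr0.
have ellU : e0 != 0 by exact: (regular_neq0 phi0 yc r0 C0).
have tau0 : phi T != 0.
  apply/eqP => t0; have : phi ell = 0.
    by rewrite E0 t0 expr0n eqn0Ngt contact_gt0 mul0r.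
  have [z zc zy] := chart_other yc => /phi0/(_ _ zc); rewrite eval_lform.
  have [Xy yi] := yc; have [Xz zi] := zc.
  move/(Mdiag Xy Xz) => [c e]; move: zy; rewrite e; move/rowP/(_ i0): e.
  by rewrite mxE zi yi mulr1 => <-; rewrite scale1r eqxx.
have he : e1 / e0 = phi T * h.
  rewrite /h E0 E1 -[in X in _ ^+ X * e0](prednK contact_gt0) exprS.
  by field; rewrite ellU expf_neq0 // tau0.
have rhe : reg (e1 / e0) (c1 / c0) by apply: regularM => //; exact: regularV.
have che : c1 / c0 != 0 by rewrite mulf_neq0 ?invr_eq0.
exists T; split=> //; first by exists (c1 / c0); rewrite // -he.
move=> k.
apply: (pole_expansion phi0 yc Tdiv he rhe che (k := d) (o := phi 'X_k / e0)).
  apply: regularM; first exact: regular_poly.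
  exact: regularV r0.
by rewrite E0; field; rewrite ellU expf_neq0.
Qed.

End BasePoint.
End Contact.

(** * The curve is rational *)

Section Parametrization.
Variables (K : numClosedFieldType) (n : nat) (X : set 'rV[K]_n).
Implicit Types (F G : {mpoly K[n]}) (x y z u v w : 'rV[K]_n).
Hypothesis Xcurve : smooth_projective_curve X.
Variable i0 : 'I_n.
Hypothesis Xi0 : exists2 u, X u & u ord0 i0 != 0.
Local Notation van := (vanishes X i0).
Local Notation chartX := (chart X i0).
Variables (L : fieldType) (phi : {rmorphism {mpoly K[n]} -> L}).
Hypothesis phi0 : forall F, phi F = 0 <-> van F.
Local Notation io := (scalars phi).
Variables (y a b : 'rV[K]_n).
Hypothesis yc : chartX y.
Hypothesis a_contact : forall z, X z -> dot a z = 0 <-> exists c, z = c *: y.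
Local Notation reg := (regular_at phi y).
Local Notation ell := (lform a).
Local Notation ell' := (lform b).
Local Notation h := (phi ell' / phi ell).
Variable T : {mpoly K[n]}.
Hypothesis T0 : eval_at T y = 0.
Hypothesis hpole : exists2 c, c != 0 & reg (phi T * h) c.
Hypothesis expansion : forall k, exists p o c,
  phi 'X_k / phi ell = (map_poly io p).[h] + o /\ reg o c.

Lemma ell_neq0 : phi ell != 0.
Proof.
apply/eqP=> e0; have [c c0 r] := hpole; move: r.
rewrite e0 invr0 mulr0 mulr0 => r; have := regular_neq0 phi0 yc r c0.
by rewrite eqxx.
Qed.

Lemma phi_homog d F : F \is d.-homog -> forall c, c != 0 ->
  phi F = c ^+ d * mmap io (fun k => phi 'X_k / c) F.
Proof.
move=> hF c c0; rewrite -(mmap_homog_scale _ _ _ hF) morph_mmap.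
by apply: mmap_ext => k; rewrite mulrC divfK.
Qed.

Lemma phi_i0 : phi 'X_i0 = 1.
Proof.
apply/eqP; rewrite -subr_eq0 -(rmorph1 phi) -rmorphB; apply/eqP/phi0.
by move=> z [_ zi]; rewrite evalB evalX eval1 zi subrr.
Qed.

Section Place.
Variable A : set (L * K).
Hypothesis Amax : maximal_alg io A.
Let Aalg : place_alg io A := Amax.1.

Lemma place_scalar c : A (io c, c).
Proof. by have [h _ _ _] := Aalg; exact: h. Qed.

Lemma placeM s t c d : A (s, c) -> A (t, d) -> A (s * t, c * d).
Proof. exact: (place_algM Aalg (v := (s, c)) (w := (t, d))). Qed.

Lemma placeD s t c d : A (s, c) -> A (t, d) -> A (s + t, c + d).
Proof. exact: (place_algD Aalg (v := (s, c)) (w := (t, d))). Qed.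

Lemma place_mmap (f : 'I_n -> L) x F :
  (forall k, A (f k, x ord0 k)) -> A (mmap io f F, eval_at F x).
Proof.
move=> hf; elim/mpoly_ring_ind: F => [c|i|p q hp hq|p q hp hq].
- by rewrite mmapC evalC; exact: place_scalar.
- by rewrite mmap_X evalX.
- by rewrite mmapD evalD; exact: placeD.
- by rewrite rmorphM /= evalM; exact: placeM.
Qed.

Lemma place_horner (p : {poly K}) s c : A (s, c) -> A ((map_poly io p).[s], p.[c]).
Proof.
move=> sc; elim/poly_ind: p => [|p e IH].
  by rewrite map_poly0 !horner0 -(rmorph0 io); exact: place_scalar.
rewrite rmorphD rmorphM /= map_polyX map_polyC !hornerE.
apply: placeD; last exact: place_scalar.
exact: placeM.
Qed.

(** In a valuation ring divisibility is total, so some coordinate divides all the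
    others. *)
Lemma dominant_coordinate : exists k, phi 'X_k != 0 /\
  forall j, exists c, A (phi 'X_j / phi 'X_k, c).
Proof.
suff H (s : seq 'I_n) : exists k, phi 'X_k != 0 /\
    forall j, j \in s -> exists c, A (phi 'X_j / phi 'X_k, c).
  by have [k [k0 hk]] := H (enum 'I_n); exists k; split=> // j; apply: hk; rewrite mem_enum.
elim: s => [|j s [k [k0 IH]]].
  by exists i0; split=> //; rewrite phi_i0 oner_neq0.
have [[c hc]|] := maximal_total Amax (phi 'X_j / phi 'X_k).
  by exists k; split=> // l; rewrite inE => /orP[/eqP->|/IH//]; exists c.
have [j0|j0] := eqVneq (phi 'X_j) 0.
  move=> _; exists k; split=> // l; rewrite inE => /orP[/eqP->|/IH//]; exists 0.
  by rewrite j0 mul0r -(rmorph0 io); exact: place_scalar.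
move=> [c hc]; exists j; split=> // l; rewrite inE => /orP[/eqP->|/IH[e he]].
  by exists 1; rewrite divff // -(rmorph1 io); exact: place_scalar.
exists (e * c); have := placeM he hc; congr (A (_, _)).
by field; rewrite k0 j0.
Qed.

(** The values of suitably scaled homogeneous coordinates satisfy the equations of
    the curve. This is where the curve being projective is used. *)
Lemma place_center : exists k (p : 'rV[K]_n),
  [/\ phi 'X_k != 0, p ord0 k = 1, X p & forall j, A (phi 'X_j / phi 'X_k, p ord0 j)].
Proof.
have [k [k0 /choice[c hc]]] := dominant_coordinate.
pose p : 'rV[K]_n := \row_j c j.
have hp j : A (phi 'X_j / phi 'X_k, p ord0 j) by rewrite mxE.
have pk : p ord0 k = 1.
  have := hp k; rewrite divff // => h1.
  apply: (place_alg_fun Aalg h1).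
  by rewrite -(rmorph1 io); exact: place_scalar.
exists k, p; split=> //.
have [[S [hS eX]] _ _ _] := Xcurve; rewrite eX; split.
  by apply/eqP=> /rowP/(_ k)/eqP; rewrite pk mxE oner_eq0.
move=> F SF; have [d hF] := hS _ SF.
have pF : phi F = 0.
  by apply/phi0 => z [Xz _]; move: Xz; rewrite eX => -[_]; apply.
move: pF; rewrite (phi_homog hF k0) => /eqP.
rewrite mulf_eq0 expf_eq0 (negPf k0) andbF /= => /eqP F0.
by have := place_mmap F hp; rewrite F0 => /(place_alg_neq0 Aalg).
Qed.

(** Away from the base point, [f] is a polynomial in quotients by [ell], which
    vanishes only there; at the base point, [f] is regular by assumption. *)
Lemma place_finite f c k p : reg f c ->
  phi 'X_k / phi ell = (map_poly io p).[h] + f -> exists s, A (f, s).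
Proof.
move=> [P [Q [Qy -> _]]] e.
have [l [q [l0 ql Xq hq]]] := place_center.
have [|aq] := eqVneq (dot a q) 0.
  move/(a_contact Xq) => [s qs].
  have s0 : s != 0.
    apply/eqP=> s0; have := ql; rewrite qs s0 scale0r mxE => /eqP.
    by rewrite eq_sym oner_eq0.
  have [_ yi] := yc.
  have lV : A ((phi 'X_l)^-1, s).
    by have := hq i0; rewrite phi_i0 qs mxE yi mulr1 mul1r.
  have ll : A (phi 'X_l, s^-1).
    by have := maximal_inv Amax s0 lV; rewrite invrK.
  have hy F : A (phi F, eval_at F y).
    rewrite morph_mmap; apply: place_mmap => j.
    have := placeM (hq j) ll; rewrite divfK // qs mxE [s * _]mulrC mulfK //.
  exists (eval_at P y * (eval_at Q y)^-1); apply: placeM => //.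
  exact: (maximal_inv Amax Qy (hy Q)).
have ellq (u : 'rV[K]_n) : A (phi (lform u) / phi 'X_l, dot u q).
  rewrite (phi_homog (lform_homog u) l0) expr1 mulrAC divff // mul1r -eval_lform.
  exact: place_mmap.
have V := maximal_inv Amax aq (ellq a).
have quot F s : A (phi F / phi 'X_l, s) -> A (phi F / phi ell, s / dot a q).
  move=> hF; have := placeM hF V; congr (A (_, _)).
  by field; rewrite l0 ell_neq0.
have -> : phi P / phi Q = phi 'X_k / phi ell - (map_poly io p).[h] by rewrite e addrC addKr.
eexists; rewrite -mulN1r -(rmorphN1 io); apply: placeD; first exact: quot.
apply: placeM; first exact: place_scalar.
by apply: place_horner; exact: quot.
Qed.

End Place.

(** A function without poles is constant: at a pole, some place of the function
    field would take the value 0 at its inverse. *)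
Lemma coordinate_polynomial k : exists p, phi 'X_k / phi ell = (map_poly io p).[h].
Proof.
have [p [o [c [e r]]]] := expansion k.
have [s os] : exists s, o = io s.
  apply: contrapT => /forallNP os.
  have [A [Amax A0]] := place_pole os.
  have [s As] := place_finite Amax r e.
  have o0 : o != 0 by apply/eqP=> o0; apply: (os 0); rewrite rmorph0.
  have := placeM Amax A0 As; rewrite mulVf // mul0r => A1.
  have := place_scalar Amax 1; rewrite rmorph1 => /(place_alg_fun Amax.1 A1)/esym/eqP.
  by rewrite oner_eq0.
exists (p + s%:P).
have -> : map_poly io (p + s%:P) = map_poly io p + (io s)%:P.
  by rewrite rmorphD /= map_polyC.
by rewrite hornerD hornerC -os.
Qed.

(** An algebraic element is constant, and [h] is not, as it has a pole. *)
Lemma h_transcendental (p : {poly K}) : (map_poly io p).[h] = 0 -> p = 0.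
Proof.
move=> ph; apply/eqP; apply: contraT => p0.
have [r pr] := closed_field_poly_normal p.
move: ph; rewrite pr map_polyZ hornerZ rmorph_prod horner_prod /= => /eqP.
rewrite mulf_eq0 -(rmorph0 io) (inj_eq (fmorph_inj io)) lead_coef_eq0 (negPf p0) /=.
rewrite rmorph0 prodf_seq_eq0 => /hasP[s _ /=]; rewrite rmorphB /= map_polyX map_polyC.
rewrite hornerXsubC subr_eq0 => /eqP hs.
have [c c0] := hpole; rewrite hs => rc.
have : reg (phi T * io s) (eval_at T y * s).
  apply: regularM => //; first exact: regular_poly.
  by rewrite -[X in reg _ X](evalC s y); exact: regular_poly.
by rewrite T0 mul0r => /(regular_fun phi0 yc rc)/eqP; rewrite (negPf c0).
Qed.

(** All conditions on the parametrization are polynomial identities in the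
    transcendental element [h], at which they hold in the function field. *)
Lemma rational_parametrization : exists Z : 'I_n -> {poly K},
  [/\ forall t, X (curve_at Z t),
      forall t, dot a (curve_at Z t) = 1,
      forall t, dot b (curve_at Z t) = t &
      forall z, X z -> dot a z != 0 ->
        z = dot a z *: curve_at Z (dot b z / dot a z)].
Proof.
have /choice[Z hZ] := coordinate_polynomial.
have ell0 := ell_neq0.
have substZ d F : F \is d.-homog ->
    phi F = phi ell ^+ d * (map_poly io (subst Z F)).[h].
  move=> hF; rewrite (phi_homog hF ell0); congr (_ * _).
  pose ev : {rmorphism {poly K} -> L} := horner_eval h \o map_poly io.
  rewrite -[RHS]/(ev (subst Z F)) /subst mmap_comp.
  rewrite (mmap_ext _ (h' := ev \o Z)); last by move=> k; rewrite hZ.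
  rewrite /mmap; apply: eq_bigr => m _; congr (_ * _).
  by rewrite /ev /= map_polyC /= /horner_eval hornerC.
have lin u : (map_poly io (subst Z (lform u))).[h] = phi (lform u) / phi ell.
  by rewrite (substZ _ _ (lform_homog u)) expr1 mulrAC divff // mul1r.
have subst_eq (p q : {poly K}) : (map_poly io p).[h] = (map_poly io q).[h] -> p = q.
  move=> e; apply/eqP; rewrite -subr_eq0; apply/eqP/h_transcendental.
  by rewrite rmorphB hornerD hornerN e subrr.
have aZ t : dot a (curve_at Z t) = 1.
  rewrite -eval_lform -horner_subst (_ : subst Z ell = 1) ?hornerC //.
  by apply: subst_eq; rewrite lin divff // rmorph1 hornerC.
have bZ t : dot b (curve_at Z t) = t.
  rewrite -eval_lform -horner_subst (_ : subst Z ell' = 'X) ?hornerX //.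
  by apply: subst_eq; rewrite lin map_polyX hornerX.
exists Z; split=> //.
  move=> t; have [[S [hS eX]] _ _ _] := Xcurve; rewrite eX; split.
    apply/eqP=> z0; have := aZ t; rewrite z0 /dot big1 => [/eqP|k _].
      by rewrite eq_sym oner_eq0.
    by rewrite mxE mulr0.
  move=> F SF; have [d hF] := hS _ SF.
  rewrite -horner_subst (_ : subst Z F = 0) ?horner0 //; apply: h_transcendental.
  have pF : phi F = 0.
    by apply/phi0 => z [Xz _]; move: Xz; rewrite eX => -[_]; apply.
  move: pF; rewrite (substZ _ _ hF) => /eqP.
  by rewrite mulf_eq0 expf_eq0 (negPf ell0) andbF /= => /eqP.
move=> z Xz az; apply/rowP=> k; rewrite !mxE.
(* the homogenization of [Z k], a form in [ell] and [ell'] *)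
pose N := size (Z k).
pose G : {mpoly K[n]} := \sum_(i < N) ((Z k)`_i)%:MP * (ell' ^+ i * ell ^+ (N - i)).
have lX (c : 'rV[K]_n) m : lform c ^+ m \is m.-homog.
  by have := dhomogMn m (lform_homog c); rewrite mul1n.
have hG : G \is N.-homog.
  apply: rpred_sum => i _; rewrite mul_mpolyC; apply: rpredZ.
  suff : ell' ^+ i * ell ^+ (N - i) \is (i + (N - i)).-homog.
    by rewrite subnKC // ltnW.
  exact: dhomogM.
have cZ i : (map_poly io (Z k))`_i = phi ((Z k)`_i)%:MP by rewrite coef_map.
have pG : phi G = phi ell ^+ N * (map_poly io (Z k)).[h].
  rewrite rmorph_sum (@horner_coef_wide _ N); last exact: size_poly.
  rewrite mulr_sumr; apply: eq_bigr => i _; rewrite !rmorphM !rmorphXn cZ.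
  have -> : phi ell ^+ N = phi ell ^+ (N - i) * phi ell ^+ i.
    by rewrite -exprD subnK // ltnW.
  by rewrite expr_div_n; field; rewrite expf_neq0.
have vE : van ('X_k * ell ^+ N - ell * G).
  apply/phi0; rewrite rmorphB !rmorphM rmorphXn pG -hZ.
  by field; rewrite ell0.
have hE : homogeneous ('X_k * ell ^+ N - ell * G).
  exists N.+1; apply: rpredB; rewrite -[N.+1]add1n; apply: dhomogM => //.
    by rewrite dhomogX /= mdeg1.
  exact: lform_homog.
have := vanishes_homog Xcurve Xi0 hE vE Xz.
rewrite evalB !evalM evalE evalX !eval_lform => /eqP; rewrite subr_eq0 => /eqP e.
have aN : dot a z ^+ N != 0 by rewrite expf_neq0.
apply: (mulIf aN); rewrite e -mulrA; congr (_ * _).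
rewrite /G eval_sum horner_coef -/N mulr_suml; apply: eq_bigr => i _.
rewrite !evalM evalC !evalE !eval_lform -mulrA; congr (_ * _).
have -> : dot a z ^+ N = dot a z ^+ (N - i) * dot a z ^+ i.
  by rewrite -exprD subnK // ltnW.
by rewrite expr_div_n; field; rewrite expf_neq0.
Qed.

End Parametrization.

(** * Regular forms on a rational curve *)

Section RationalFunctions.
Variable K : numClosedFieldType.
Implicit Types (p q U V : {poly K}).

Lemma poly_zero_fun p : (forall t, p.[t] = 0) -> p = 0.
Proof.
move=> h; apply/eqP; apply: contraT => p0.
have := @max_poly_roots _ p [seq i%:R | i <- iota 0 (size p)] p0.
rewrite size_map size_iota ltnn; apply=> //.
  by apply/allP=> t _; apply/rootP.
rewrite map_inj_uniq ?iota_uniq // => i j /eqP.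
by rewrite eqr_nat => /eqP.
Qed.

Lemma rational_agree (r : K -> K) U V U' V' : V != 0 -> V' != 0 ->
  (forall t, V.[t] != 0 -> r t = U.[t] / V.[t]) ->
  (forall t, V'.[t] != 0 -> r t = U'.[t] / V'.[t]) -> U * V' = U' * V.
Proof.
move=> V0 V0' h h'; have : (U * V' - U' * V) * (V * V') = 0.
  apply: poly_zero_fun => t; rewrite !(hornerM, hornerD, hornerN).
  have [->|Vt] := eqVneq V.[t] 0; first by rewrite mul0r mulr0.
  have [->|Vt'] := eqVneq V'.[t] 0; first by rewrite !mulr0.
  have := h t Vt; rewrite (h' t Vt') => /eqP; rewrite eqr_div // => /eqP ->.
  by rewrite subrr mul0r.
by move/eqP; rewrite !mulf_eq0 (negPf V0) (negPf V0') !orbF subr_eq0 => /eqP.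
Qed.

(** A root of the denominator of a global expression can be cancelled, by comparing
    with the expression that is valid there; in the end the denominator is constant
    and the numerator has a smaller degree. *)
Lemma rational_zero (r : K -> K) :
  (forall t0, exists U V, V.[t0] != 0 /\ forall t, V.[t] != 0 -> r t = U.[t] / V.[t]) ->
  (exists U V, (size U < size V)%N /\ forall t, V.[t] != 0 -> r t = U.[t] / V.[t]) ->
  forall t, r t = 0.
Proof.
move=> hloc [U [V [UV hr]]].
have [m Vm] := ubnP (size V); elim: m U V Vm UV hr => // m IH U V Vm UV hr.
have V0 : V != 0 by rewrite -size_poly_gt0; exact: leq_ltn_trans UV.
have [/eqP/size_poly1P[c c0 Vc]|/closed_rootP[t0 Vt0]] := eqVneq (size V) 1%N.
  move=> t; have U0 : U = 0.
    by apply/eqP; rewrite -size_poly_eq0 -leqn0 -ltnS; move: UV; rewrite Vc size_polyC c0.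
  by rewrite hr ?U0 ?horner0 ?mul0r // Vc hornerC.
have [U0 [V0' [V0t h0]]] := hloc t0.
have V0'0 : V0' != 0 by apply: contra V0t => /eqP->; rewrite horner0.
have e := rational_agree V0 V0'0 hr h0.
have Ut0 : root U t0.
  have := congr1 (fun p => p.[t0]) e; rewrite /= !hornerM (rootP Vt0) mulr0 => /eqP.
  by rewrite mulf_eq0 (negPf V0t) orbF.
have /factor_theorem[U' eU] := Ut0; have /factor_theorem[V' eV] := Vt0.
have x0 : 'X - t0%:P != 0 :> {poly K} by rewrite polyXsubC_eq0.
have e' : U' * V0' = U0 * V'.
  by apply: (mulIf x0); rewrite mulrAC -eU e eV mulrA.
have V'0 : V' != 0 by apply: contra V0 => /eqP V'0; rewrite eV V'0 mul0r.
have sV : size V = (size V').+1 by rewrite eV size_Mmonic ?monicXsubC // size_XsubC addn2.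
apply: (IH U' V'); first by rewrite -ltnS -sV.
  have [->|U'0] := eqVneq U' 0; first by rewrite size_poly0 size_poly_gt0.
  by rewrite -ltnS -sV; move: UV; rewrite {1}eU size_Mmonic ?monicXsubC // size_XsubC addn2.
move=> t V't; have [tt|tt0] := eqVneq t t0; last first.
  have xt : ('X - t0%:P).[t] != 0 by rewrite hornerXsubC subr_eq0.
  have Vt : V.[t] != 0 by rewrite eV hornerM mulf_neq0.
  by rewrite (hr _ Vt) eU eV !hornerM -mulf_div divff // mulr1.
rewrite tt in V't *; rewrite (h0 _ V0t); apply/eqP; rewrite eqr_div // -!hornerM -e'.
exact: eqxx.
Qed.

(** Here [c] may be zero, which makes the notion stable under sums. *)
Definition top_coef (k : nat) p (c : K) : Prop := (size p <= k.+1)%N /\ p`_k = c.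

Lemma top_coefC c : top_coef 0 c%:P c.
Proof. by split; [rewrite size_polyC; case: (c != 0) | rewrite coefC]. Qed.

Lemma top_coefD k p q c d : top_coef k p c -> top_coef k q d ->
  top_coef k (p + q) (c + d).
Proof.
move=> [sp pk] [sq qk]; split; last by rewrite coefD pk qk.
by apply: leq_trans (size_polyD _ _) _; rewrite geq_max sp sq.
Qed.

Lemma top_coefM k l p q c d : top_coef k p c -> top_coef l q d ->
  top_coef (k + l) (p * q) (c * d).
Proof.
move=> [sp pk] [sq ql]; split.
  apply: leq_trans (size_polyMleq _ _) _.
  by move: sp sq; move: (size p) (size q); clear; lia.
have kl : (k < (k + l).+1)%N by rewrite ltnS leq_addr.
rewrite coefM (bigD1 (Ordinal kl)) //= addKn pk ql big1 ?addr0 // => j jk.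
have {}jk : (j : nat) != k by apply: contra jk => /eqP jk; apply/eqP/val_inj.
have [kj|jk'] := ltnP k j.
  by rewrite nth_default ?mul0r //; exact: leq_trans kj.
rewrite [q`__]nth_default ?mulr0 //; apply: leq_trans sq _.
by move: jk jk'; clear; lia.
Qed.

Lemma top_coefX k p c m : top_coef k p c -> top_coef (k * m) (p ^+ m) (c ^+ m).
Proof.
move=> h; elim: m => [|m IH]; first by rewrite muln0 !expr0; exact: top_coefC.
by rewrite !exprS mulnS; exact: top_coefM.
Qed.

Lemma subst_top n (Z : 'I_n -> {poly K}) (N d : nat) (e : 'rV[K]_n) F :
  (forall i, top_coef N (Z i) (e ord0 i)) -> F \is d.-homog ->
  top_coef (N * d) (subst Z F) (eval_at F e).
Proof.
move=> hZ /dhomogP hF; rewrite /subst /mmap /eval_at mevalE !big_seq.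
elim/big_ind2 : _ => [|p c q c' hp hq|m mF].
- by split; [rewrite size_poly0 | rewrite coef0].
- exact: top_coefD.
- rewrite -[(N * d)%N]add0n; apply: top_coefM; first exact: top_coefC.
  rewrite -(hF _ mF) /= mdegE /mmap1 big_distrr /=.
  elim/big_ind3 : _ => [|k p c l q c' hp hq|i _]; first exact: top_coefC.
    exact: top_coefM.
  exact: top_coefX.
Qed.

End RationalFunctions.

Section FormsOnParametrizedCurves.
Variables (K : numClosedFieldType) (n : nat) (X : set 'rV[K]_n).
Implicit Types (F G : {mpoly K[n]}) (x y z u v w : 'rV[K]_n).
Hypothesis Xcurve : smooth_projective_curve X.
Variables (a b y : 'rV[K]_n) (Z : 'I_n -> {poly K}) (lam : K).
Hypothesis Xy : X y.
Hypothesis a_contact : forall z, X z -> dot a z = 0 <-> exists c, z = c *: y.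
Hypothesis lam0 : lam != 0.
Hypothesis ZX : forall t, X (curve_at Z t).
Hypothesis Za : forall t, dot a (curve_at Z t) = lam.
Hypothesis Zb : forall t, dot b (curve_at Z t) = lam * t.

Lemma lincomb_Z (u : 'rV[K]_n) t :
  (\sum_k (u ord0 k)%:P * Z k).[t] = dot u (curve_at Z t).
Proof. by rewrite horner_sum; apply: eq_bigr => k _; rewrite hornerM hornerC mxE. Qed.

Lemma lincomb_a : \sum_k (a ord0 k)%:P * Z k = lam%:P.
Proof.
apply/eqP; rewrite -subr_eq0; apply/eqP/poly_zero_fun => t.
by rewrite hornerD hornerN hornerC lincomb_Z Za subrr.
Qed.

Lemma lincomb_b : \sum_k (b ord0 k)%:P * Z k = lam%:P * 'X.
Proof.
apply/eqP; rewrite -subr_eq0; apply/eqP/poly_zero_fun => t.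
by rewrite hornerD hornerN hornerM hornerC hornerX lincomb_Z Zb subrr.
Qed.

Lemma dot_velocity u t :
  dot u (velocity_at Z t) = (\sum_k (u ord0 k)%:P * Z k)^`().[t].
Proof.
rewrite raddf_sum horner_sum; apply: eq_bigr => k _ /=.
by rewrite derivM derivC mul0r add0r hornerM hornerC mxE.
Qed.

Lemma subst_eq0 F : (forall x, X x -> eval_at F x = 0) -> subst Z F = 0.
Proof. by move=> h; apply: poly_zero_fun => t; rewrite horner_subst h. Qed.

Lemma tangent_velocity t : tangent X (curve_at Z t) (velocity_at Z t).
Proof.
move=> F _ FX; rewrite -horner_deriv_subst (subst_eq0 FX).
by rewrite deriv0 horner0.
Qed.

Lemma curve_at_neq0 t : curve_at Z t != 0.
Proof. exact: (curve_neq0 Xcurve (ZX t)). Qed.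

Lemma tangent_curve_at t w : tangent X (curve_at Z t) w ->
  exists c d, w = c *: curve_at Z t + d *: velocity_at Z t.
Proof.
move=> tw; apply: (tangent_span Xcurve (ZX t)) => //.
- exact: tangent_point.
- exact: tangent_velocity.
- exact: curve_at_neq0.
move=> c e; have := dot_velocity a t.
rewrite lincomb_a derivC horner0 e dotZr Za => /eqP.
rewrite mulf_eq0 (negPf lam0) orbF => /eqP c0.
have := dot_velocity b t.
rewrite lincomb_b derivM derivC mul0r add0r derivX mulr1 hornerC e c0 scale0r.
rewrite /dot big1 => [/esym/eqP|k _]; first by rewrite (negPf lam0).
by rewrite mxE mulr0.
Qed.

(** The vector of the top coefficients lies on the curve and on the polar hyperplane
    of the base point, so it is a multiple of the base point. *)
Lemma point_at_infinity : exists N c, [/\ c != 0 &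
  forall i, top_coef N (Z i) ((c *: y) ord0 i)].
Proof.
pose N := \max_i (size (Z i)).-1.
have sN i : (size (Z i) <= N.+1)%N.
  apply: leq_trans (leqSpred _) _; rewrite ltnS.
  exact: (leq_bigmax (F := fun i => (size (Z i)).-1)).
pose e : 'rV[K]_n := \row_i (Z i)`_N.
have eN i : top_coef N (Z i) (e ord0 i) by split; rewrite ?mxE.
(* [Z] is not constant, so [N] is positive and the constant [dot a (Z t)] has no
   coefficient in degree [N] *)
have N0 : (0 < N)%N.
  rewrite lt0n; apply/eqP=> N0.
  have cst t : curve_at Z t = curve_at Z 0.
    apply/rowP=> i; rewrite !mxE; have := sN i; rewrite N0 => /size1_polyC ->.
    by rewrite !hornerC.
  have := Zb 1; rewrite cst Zb mulr0 mulr1 => /esym/eqP.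
  by rewrite (negPf lam0).
have e0 : e != 0.
  have [i0 iN] : exists i0, N = (size (Z i0)).-1.
    have [|i0 _] := @eq_bigmax_cond _ predT (fun i => (size (Z i)).-1).
      rewrite lt0n; apply/negP=> /eqP/card0_eq T0.
      by move: N0; rewrite /N big_pred0 // => i; rewrite -[RHS](T0 i).
    by exists i0.
  apply/eqP=> /rowP/(_ i0)/eqP; rewrite !mxE iN -lead_coefE lead_coef_eq0 => /eqP z0.
  by move: N0; rewrite iN z0 size_poly0.
have Xe : X e.
  have [[S [hS eX]] _ _ _] := Xcurve; rewrite eX; split=> // F SF.
  have [d hF] := hS _ SF; have [_ <-] := subst_top eN hF.
  rewrite subst_eq0 ?coef0 // => x; rewrite eX => -[_]; exact.
have ae : dot a e = 0.
  have := congr1 (fun p : {poly K} => p`_N) lincomb_a.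
  rewrite /= coef_sum coefC eqn0Ngt N0 /= => e1; rewrite -[RHS]e1.
  by apply: eq_bigr => k _; rewrite coefCM mxE.
have /(a_contact Xe)[c ec] := ae.
exists N, c; split; last by rewrite -ec.
by apply: contra e0 => /eqP c0; rewrite ec c0 scale0r.
Qed.

Section LocalExpression.
Variables (eta : 'rV[K]_n -> 'rV[K]_n -> K) (r : nat) (f g : 'I_r -> ratfun K n).
Hypothesis eta_eq : forall z, X z ->
  (forall i, rf_defined (f i) z /\ rf_defined (g i) z) ->
  forall w, tangent X z w ->
    eta z w = \sum_(i < r) rf_val (f i) z * rf_diff (g i) z w.

Let P i := subst Z (rf_num (f i)).
Let Q i := subst Z (rf_den (f i)).
Let A i := subst Z (rf_num (g i)).
Let B i := subst Z (rf_den (g i)).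
(** With [f] and [g] pulled back to [P / Q] and [A / B], the term [f * g'] is
    [term_num / term_den]. *)
Definition term_num i : {poly K} := P i * ((A i)^`() * B i - A i * (B i)^`()).
Definition term_den i : {poly K} := Q i * B i ^+ 2.
Definition pullback_num : {poly K} :=
  \sum_i term_num i * \prod_(j | j != i) term_den j.
Definition pullback_den : {poly K} := \prod_i term_den i.

Lemma pullback_eval t : pullback_den.[t] != 0 ->
  eta (curve_at Z t) (velocity_at Z t) = pullback_num.[t] / pullback_den.[t].
Proof.
rewrite horner_prod => /prodf_neq0 h.
have hi i : (Q i).[t] != 0 /\ (B i).[t] != 0.
  have := h i isT; rewrite hornerM horner_exp mulf_eq0 negb_or expf_eq0 /=.
  by case/andP.
rewrite eta_eq //; last exact: tangent_velocity.
  rewrite /pullback_num horner_sum mulr_suml; apply: eq_bigr => i _.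
  have -> : \prod_j (term_den j).[t] =
      (term_den i).[t] * \prod_(j | j != i) (term_den j).[t] by rewrite (bigD1 i).
  rewrite hornerM horner_prod -mulf_div divff ?mulr1; last first.
    by apply/prodf_neq0 => j ji; exact: h.
  rewrite /rf_val /rf_diff /term_num /term_den !(hornerM, hornerD, hornerN, horner_exp).
  by rewrite !horner_deriv_subst !horner_subst mulf_div.
by move=> i; rewrite /rf_defined -!horner_subst; exact: hi.
Qed.

Lemma pullback_den_neq0 t :
  (forall i, rf_defined (f i) (curve_at Z t) /\ rf_defined (g i) (curve_at Z t)) ->
  pullback_den.[t] != 0.
Proof.
move=> h; rewrite horner_prod; apply/prodf_neq0 => i _.
rewrite hornerM horner_exp !horner_subst; have [h1 h2] := h i.
by rewrite mulf_neq0 // expf_neq0.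
Qed.

(** Both [f] and [g] are finite at infinity, so the numerators of their pullbacks do
    not exceed the denominators in degree; taking the derivative of the pullback of
    [g] lowers the degree. *)
Lemma pullback_infinity : (forall i, rf_defined (f i) y /\ rf_defined (g i) y) ->
  (size pullback_num < size pullback_den)%N.
Proof.
move=> h; have [N [c [c0 hN]]] := point_at_infinity.
have topden (q : ratfun K n) : rf_defined q y ->
    size (subst Z (rf_den q)) = (N * rf_deg q).+1 /\
    (size (subst Z (rf_num q)) <= (N * rf_deg q).+1)%N.
  move=> qy; have [s1 e1] := subst_top hN (rf_den_homog q).
  have [s2 _] := subst_top hN (rf_num_homog q); split=> //.
  apply/eqP; rewrite eqn_leq s1 /= ltnNge; apply/negP=> /leq_sizeP/(_ _ (leqnn _)).
  rewrite e1 (eval_homog_scale _ _ (rf_den_homog q)) => /eqP.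
  by rewrite mulf_eq0 expf_eq0 (negPf c0) andbF (negPf qy).
have term i : (size (term_num i) < size (term_den i))%N.
  have [fy gy] := h i; have [sQ sP] := topden _ fy; have [sB sA] := topden _ gy.
  have Q0 : Q i != 0 by rewrite -size_poly_gt0 sQ.
  have B0 : B i != 0 by rewrite -size_poly_gt0 sB.
  have [->|A0] := eqVneq (term_num i) 0.
    by rewrite size_poly0 size_poly_gt0 mulf_neq0 ?expf_neq0.
  have sD : (size ((A i)^`() * B i - A i * (B i)^`())%R <= (N * rf_deg (g i)).*2)%N.
    have sd (p : {poly K}) k : (size p <= k.+1)%N -> (size p^`() <= k)%N.
      by move=> sp; apply/leq_sizeP => j kj; rewrite coef_deriv nth_default ?mul0rn // (leq_trans sp).
    have ar1 (p q v : nat) : (p <= v)%N -> (q <= v.+1)%N -> ((p + q).-1 <= v.*2)%N by lia.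
    have sA' := sd _ _ sA; have sB' := sd _ _ (eq_leq sB).
    apply: leq_trans (size_polyD _ _) _; rewrite size_polyN geq_max.
    apply/andP; split; apply: leq_trans (size_polyMleq _ _) _.
      exact: ar1 sA' (eq_leq sB).
    by rewrite addnC; exact: ar1 sB' sA.
  have -> : size (term_den i) = (size (Q i) + (size (B i) + size (B i)).-1).-1.
    by rewrite /term_den expr2 size_mul ?mulf_neq0 // size_mul.
  rewrite sQ sB; apply: leq_ltn_trans (size_polyMleq _ _) _.
  have ar (p q u v : nat) : (p <= u.+1)%N -> (q <= v.*2)%N ->
      ((p + q).-1 < (u.+1 + (v.+1 + v.+1).-1).-1)%N by lia.
  exact: ar.
have den0 i : term_den i != 0 by rewrite -size_poly_gt0; exact: leq_ltn_trans (term i).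
have D0 : pullback_den != 0 by apply/prodf_neq0.
apply: leq_ltn_trans (size_sum _ _ _) _.
rewrite -(prednK (n := size pullback_den)) ?size_poly_gt0 // ltnS.
apply/bigmax_leqP => i _; rewrite -ltnS prednK ?size_poly_gt0 //.
have -> : pullback_den = term_den i * \prod_(j | j != i) term_den j.
  by rewrite /pullback_den (bigD1 i).
have R0 : \prod_(j | j != i) term_den j != 0 by apply/prodf_neq0.
have [->|n0] := eqVneq (term_num i) 0.
  by rewrite mul0r size_poly0 lt0n size_poly_eq0; exact: mulf_neq0.
rewrite (size_mul n0 R0) (size_mul (den0 i) R0); rewrite -size_poly_gt0 in R0.
have ar (p q s : nat) : (0 < s)%N -> (p < q)%N -> ((p + s).-1 < (q + s).-1)%N by lia.
exact: ar R0 (term i).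
Qed.

(** The form is linear on tangent vectors and zero on the point itself, by Euler's
    relation in degree zero. *)
Lemma eta_point t : (forall i, rf_defined (f i) (curve_at Z t) /\
    rf_defined (g i) (curve_at Z t)) -> forall c d,
  eta (curve_at Z t) (c *: curve_at Z t + d *: velocity_at Z t) =
  d * eta (curve_at Z t) (velocity_at Z t).
Proof.
move=> h c d.
have tv := tangent_velocity t; have tp := tangent_point (ZX t).
rewrite !eta_eq //; last first.
  apply: tangent_lin => //; rewrite -[d *: _]addr0; apply: tangent_lin => //.
  by move=> F _ _; rewrite /diff_at big1 // => i _; rewrite mxE mulr0.
rewrite mulr_sumr; apply: eq_bigr => i _; rewrite [RHS]mulrCA; congr (_ * _).
rewrite /rf_diff; set q := g i.
have dl F : diff_at F (curve_at Z t) (c *: curve_at Z t + d *: velocity_at Z t) =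
    c * diff_at F (curve_at Z t) (curve_at Z t) +
    d * diff_at F (curve_at Z t) (velocity_at Z t).
  rewrite diff_lin -[d *: _]addr0 diff_lin [diff_at _ _ 0]big1 ?addr0 // => j _.
  by rewrite mxE mulr0.
rewrite !dl (euler _ (rf_num_homog q)) (euler _ (rf_den_homog q)) [RHS]mulrA.
congr (_ / _); ring.
Qed.

End LocalExpression.

Lemma regular_form_zero eta : regular_form X eta ->
  forall t w, tangent X (curve_at Z t) w -> eta (curve_at Z t) w = 0.
Proof.
move=> reta.
have h t : eta (curve_at Z t) (velocity_at Z t) = 0.
  apply: (rational_zero (r := fun t => eta (curve_at Z t) (velocity_at Z t))).
    move=> t0; have [r [f [g [hd he]]]] := reta _ (ZX t0).
    exists (pullback_num f g), (pullback_den f g); split; first exact: pullback_den_neq0.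
    by move=> s hs; exact: (pullback_eval he).
  have [r [f [g [hd he]]]] := reta _ Xy.
  exists (pullback_num f g), (pullback_den f g); split; first exact: pullback_infinity.
  by move=> s hs; exact: (pullback_eval he).
move=> t w /tangent_curve_at[c [d ->]].
have [r [f [g [hd he]]]] := reta _ (ZX t).
by rewrite (eta_point he hd) h mulr0.
Qed.

End FormsOnParametrizedCurves.

(** * The Klein quadric *)

Section Plucker.
Variable K : fieldType.
Implicit Types (u v x z : 'rV[K]_4).

(** The Gram matrix of the bilinear form of the Klein quadric: with the order of the
    pairs in [plucker_pairs], complementary pairs have indices of sum 5, and the
    sign is that of the corresponding permutation. *)
Definition klein : 'M[K]_6 := \matrix_(i, j)
  if (i + j == 5)%N then if (i == 1%N :> nat) || (i == 4 :> nat) then -1 else 1 else 0.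

(** Laplace expansion along the first two rows. *)
Lemma det4 (A : 'M[K]_4) (f : nat -> nat -> K) : (forall i j, A i j = f i j) ->
  \det A =
    (f 0 0 * f 1 1 - f 0 1 * f 1 0) * (f 2 2 * f 3 3 - f 2 3 * f 3 2)
  - (f 0 0 * f 1 2 - f 0 2 * f 1 0) * (f 2 1 * f 3 3 - f 2 3 * f 3 1)
  + (f 0 0 * f 1 3 - f 0 3 * f 1 0) * (f 2 1 * f 3 2 - f 2 2 * f 3 1)
  + (f 0 1 * f 1 2 - f 0 2 * f 1 1) * (f 2 0 * f 3 3 - f 2 3 * f 3 0)
  - (f 0 1 * f 1 3 - f 0 3 * f 1 1) * (f 2 0 * f 3 2 - f 2 2 * f 3 0)
  + (f 0 2 * f 1 3 - f 0 3 * f 1 2) * (f 2 0 * f 3 1 - f 2 1 * f 3 0).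
Proof.
move=> hf.
rewrite (expand_det_row _ ord0) !big_ord_recl big_ord0 /cofactor.
rewrite !(expand_det_row _ (ord0 : 'I_3)) !big_ord_recl !big_ord0 /cofactor.
rewrite !(expand_det_row _ (ord0 : 'I_2)) !big_ord_recl !big_ord0 /cofactor !det_mx11.
rewrite !mxE !hf /= /bump /=.
ring.
Qed.

Lemma klein_plucker u v x z : bil klein (plucker u v) (plucker x z) =
  \det (\matrix_(i < 4, j < 4) (nth 0 [:: u; v; x; z] i) ord0 j).
Proof.
pose f (i j : nat) := (nth 0 [:: u; v; x; z] i) ord0 (inord j).
have nE (w : 'rV[K]_4) (i : nat) (j : 'I_4) : nth 0 [:: u; v; x; z] i = w -> w ord0 j = f i j.
  by move=> <-; rewrite /f inord_val.
rewrite (det4 (f := f)); last by move=> i j; rewrite mxE /f inord_val.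
rewrite /bil /dot !big_ord_recl big_ord0 !mxE !big_ord_recl !big_ord0 !mxE /=.
rewrite !(nE u 0%N) // !(nE v 1%N) // !(nE x 2) // !(nE z 3) //.
rewrite /bump /=.
ring.
Qed.

Lemma klein_isotropic u v : bil klein (plucker u v) (plucker u v) = 0.
Proof.
rewrite klein_plucker; apply: (@determinant_alternate _ _ _ 0 2%:R) => // j.
by rewrite !mxE.
Qed.

Lemma line_basis (V : {vspace 'rV[K]_4}) u v : \dim V = 2%N -> V = <<[:: u; v]>>%VS ->
  forall c d, c *: u + d *: v = 0 -> c = 0 /\ d = 0.
Proof.
move=> dV eV c d e.
have /freeP fr : free [tuple u; v] by rewrite /free -eV dV.
have h := fr (fun i => nth 0 [:: c; d] i).
have {}h : forall i : 'I_2, nth 0 [:: c; d] i = 0.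
  by apply: h; rewrite !big_ord_recl big_ord0 /= addr0.
by split; [exact: (h 0) | exact: (h 1)].
Qed.

Lemma line_mem u v w : w \in <<[:: u; v]>>%VS -> exists c d, w = c *: u + d *: v.
Proof.
rewrite span_cons span_seq1.
by move/memv_addP=> [_ /vlineP[c ->] [_ /vlineP[d ->] ->]]; exists c, d.
Qed.

Lemma mem_line u v c d : c *: u + d *: v \in <<[:: u; v]>>%VS.
Proof. by rewrite memvD // memvZ // memv_span // !inE eqxx ?orbT. Qed.

Lemma plucker_same_line (V : {vspace 'rV[K]_4}) u v x z :
  V = <<[:: u; v]>>%VS -> V = <<[:: x; z]>>%VS ->
  exists c, plucker x z = c *: plucker u v.
Proof.
move=> eV eV'.
have [a [b ex]] : exists a b, x = a *: u + b *: v.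
  by apply: line_mem; rewrite -eV eV' memv_span // !inE eqxx.
have [c [d ez]] : exists c d, z = c *: u + d *: v.
  by apply: line_mem; rewrite -eV eV' memv_span // !inE eqxx orbT.
exists (a * d - b * c); apply/rowP=> k; rewrite ex ez !mxE.
by case: (tnth plucker_pairs k) => i j /=; rewrite !mxE; ring.
Qed.

Lemma plucker_disjoint (V V' : {vspace 'rV[K]_4}) u v x z :
  \dim V = 2%N -> \dim V' = 2%N -> V = <<[:: u; v]>>%VS -> V' = <<[:: x; z]>>%VS ->
  (V :&: V')%VS = 0%VS -> bil klein (plucker u v) (plucker x z) != 0.
Proof.
move=> dV dV' eV eV' VV'; rewrite klein_plucker; apply/det0P => -[w w0 wA].
have e : w ord0 0 *: u + w ord0 1 *: v =
    (- w ord0 2%:R) *: x + (- w ord0 3%:R) *: z.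
  apply/rowP=> j; have /rowP/(_ j) := wA.
  rewrite !mxE !big_ord_recl big_ord0 !mxE /= addr0.
  have -> : lift ord0 (lift ord0 ord0) = 2%:R :> 'I_4 by apply: val_inj.
  have -> : lift ord0 (lift ord0 (lift ord0 ord0)) = 3%:R :> 'I_4 by apply: val_inj.
  have -> : lift ord0 ord0 = 1 :> 'I_4 by apply: val_inj.
  have -> : ord0 = 0 :> 'I_4 by apply: val_inj.
  move=> e; apply/eqP; rewrite -subr_eq0 -[X in _ == X]e; apply/eqP; ring.
have mV : w ord0 0 *: u + w ord0 1 *: v \in (V :&: V')%VS.
  by rewrite memv_cap {1}eV mem_line e eV' mem_line.
move: mV; rewrite VV' memv0 => /eqP e0.
have [h0 h1] := line_basis dV eV e0.
have [h2 h3] := line_basis dV' eV' (etrans (esym e) e0).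
move/eqP: w0; apply; apply/rowP=> i; rewrite mxE.
move/eqP: h2; rewrite oppr_eq0 => /eqP h2; move/eqP: h3; rewrite oppr_eq0 => /eqP h3.
case: i => -[|[|[|[|//]]]] lt; [rewrite -[RHS]h0|rewrite -[RHS]h1|rewrite -[RHS]h2|rewrite -[RHS]h3];
  by congr (w _ _); apply: val_inj.
Qed.

End Plucker.

(** * The genus *)

Lemma curve_two_points (K : fieldType) n (X : set 'rV[K]_n) : has_chain X 1 ->
  exists u v, [/\ X u, X v & forall c, v <> c *: u].
Proof.
move=> [Z [hZ hlt]].
have [cl0 [[u Zu] _] ZX] := hZ 0%N isT.
have [[S [_ eZ1]] _ ZX1] := hZ 1%N isT.
have [_ /existsNP[v /not_implyP[Zv nZv]]] := hlt 0%N isT.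
exists u, v; split; [exact: ZX | exact: ZX1 |].
move=> c e; apply: nZv; rewrite e; apply: proj_closed_scale => //.
move: Zv; rewrite eZ1 => -[v0 _].
by apply: contra v0 => /eqP c0; rewrite e c0 scale0r.
Qed.

Section Genus.
Variables (K : numClosedFieldType) (n : nat) (X : set 'rV[K]_n) (M : 'M[K]_n).
Hypothesis Xcurve : smooth_projective_curve X.
Hypothesis Mdiag : forall x z, X x -> X z ->
  bil M x z = 0 <-> exists c, z = c *: x.

(** The parametrization by a base point says nothing about the form at that point
    itself, so two base points are used. *)
Lemma regular_forms_vanish eta : regular_form X eta ->
  forall x, X x -> forall w, tangent X x w -> eta x w = 0.
Proof.
move=> reta.
have Xtwo : exists u v, [/\ X u, X v & forall c, v <> c *: u].
  by apply: curve_two_points; case: Xcurve => _ _ [].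
have [i0 Xi0] : exists i0, exists2 u, X u & u ord0 i0 != 0.
  have [u [_ [Xu _ _]]] := Xtwo; have u0 := curve_neq0 Xcurve Xu.
  apply: contrapT => /forallNP h; move/eqP: u0; apply; apply/rowP=> i.
  by rewrite mxE; apply/eqP; apply: contraT => ui; case: (h i); exists u.
have [L [phi [phi0 phi_frac]]] := residue_fieldP (vanishes_prime Xcurve Xi0).
have [W [Wvan Wn0]] := vector_field Xcurve Xi0 phi0 phi_frac.
have [d [nd dmin]] := contact_order Xcurve Mdiag Xi0 Xtwo phi0 Wvan Wn0.
have base y : chart X i0 y -> eval_at (jet_pairing M W 0 d) y != 0 ->
    exists2 a : 'rV[K]_n, (forall z, X z -> dot a z = 0 <-> exists c, z = c *: y) &
    forall x, X x -> dot a x != 0 -> forall w, tangent X x w -> eta x w = 0.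
  move=> yc dy; have [Xy _] := yc.
  have ac z : X z -> dot (y *m M) z = 0 <-> exists c, z = c *: y by exact: Mdiag.
  exists (y *m M) => // x Xx ax w tw.
  have [T [T0 hpole _ expansion]] :=
    coordinate_expansion Xcurve Mdiag Xi0 Xtwo phi0 Wvan yc dy dmin.
  have [Z [ZX Za Zb Zall]] :=
    rational_parametrization Xcurve Xi0 phi0 yc ac T0 hpole expansion.
  pose lam := dot (y *m M) x; pose Zl i := lam%:P * Z i.
  have Zl_at t : curve_at Zl t = lam *: curve_at Z t.
    by apply/rowP=> i; rewrite !mxE hornerM hornerC.
  have ex : x = curve_at Zl (dot (vfield_at W y *m M) x / lam).
    by rewrite Zl_at; exact: Zall.
  rewrite ex; apply: (regular_form_zero Xcurve Xy ac (b := vfield_at W y *m M) (lam := lam)) => //.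
  - by move=> t; rewrite Zl_at; apply: curve_scale.
  - by move=> t; rewrite Zl_at dotZr Za mulr1.
  - by move=> t; rewrite Zl_at dotZr Zb.
  - by rewrite -ex.
have [y1 [yc1 _ dy1]] := chart_avoid Xcurve Xi0 Xtwo 0 nd.
have [y2 [yc2 y12 dy2]] := chart_avoid Xcurve Xi0 Xtwo y1 nd.
have [a1 ac1 h1] := base _ yc1 dy1; have [a2 ac2 h2] := base _ yc2 dy2.
move=> x Xx w tw.
have [a1x|a1x] := eqVneq (dot a1 x) 0; last exact: (h1 x).
have [a2x|a2x] := eqVneq (dot a2 x) 0; last exact: (h2 x).
have [c1 e1] := (ac1 x Xx).1 a1x; have [c2 e2] := (ac2 x Xx).1 a2x.
have [[_ y1i] [_ y2i]] := (yc1, yc2).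
have c12 : c1 = c2.
  by have /rowP/(_ i0) := etrans (esym e1) e2; rewrite !mxE y1i y2i !mulr1.
have c10 : c1 != 0.
  have := curve_neq0 Xcurve Xx; rewrite e1 scaler_eq0 negb_or.
  by case/andP.
case/eqP: y12; apply: (scalerI c10).
by rewrite {1}c12 -e2 e1.
Qed.

Theorem genus_zero : has_genus X 0.
Proof.
exists (fun=> fun _ _ => 0); split; first by case.
move=> eta reta; exists 0; split=> [x Xx w tw|c _]; last by rewrite [c]thinmx0.
by rewrite big_ord0; exact: regular_forms_vanish.
Qed.

End Genus.

Theorem lemma3p11 (R : realType) (C : set (Gr13 R[i]))
  (C_curve : smooth_projective_curve (plucker_image C))
  (C_disjoint : forall L M : Gr13 R[i], C L -> C M -> L <> M ->
     (line_space L :&: line_space M)%VS = 0%VS) :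
  has_genus (plucker_image C) 0.
Proof.
apply: (@genus_zero _ _ _ (klein _) C_curve) => _ _ [L [u [v [CL eL ->]]]] [M [x [z [CM eM ->]]]].
split=> [B0|[c ->]]; last by rewrite /bil dotZr -/(bil _ _ _) klein_isotropic mulr0.
case: (pselect (L = M)) => [LM|/(C_disjoint _ _ CL CM) LM].
  by apply: (plucker_same_line eL); rewrite LM.
have := plucker_disjoint (eqP (valP L)) (eqP (valP M)) eL eM LM.
by rewrite B0 eqxx.
Qed.
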